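(* Let $\mathcal{K}$ be a 2-category with finite limits and finite colimits. Then $\mathcal{K}$ becomes a model $\mathbf{Cat}$-category in which the weak equivalences are the (adjoint) equivalences of $\mathcal{K}$ and the fibrations are the isofibrations of $\mathcal{K}$ (and the cofibrations are the morphisms with the left lifting property with respect to the trivial fibrations). Moreover, the factorizations are functorial, and every object is both fibrant and cofibrant.
   Context: Finite limits and colimits in a 2-category are meant in the $\mathbf{Cat}$-enriched sense: finite conical limits and colimits with their 2-dimensional universal properties, together with cotensors and tensors by the arrow category $\mathbf{2}=\{0\to1\}$. A morphism $f:A\to B$ in a 2-category is an equivalence if there is $g:B\to A$ with $gf\cong 1_A$ and $fg\cong 1_B$ (the isomorphisms can always be chosen to satisfy the triangle equations, giving an adjoint equivalence). It is an isofibration if for all $a:X\to A$, $b:X\to B$ and every invertible 2-cell $\beta:b\cong fa$ there are $a':X\to A$ and an invertible 2-cell $\alpha:a'\cong a$ with $fa'=b$ and $f\alpha=\beta$. In $\mathbf{Cat}$ an isofibration is a functor $p:E\to B$ such that every isomorphism $\beta:b\cong pe$ in $B$ lifts to an isomorphism $\epsilon:e'\cong e$ in $E$ with $pe'=b$, $p\epsilon=\beta$. A model $\mathbf{Cat}$-category is a 2-category $\mathcal{K}$ with finite limits and colimits (in the $\mathbf{Cat}$-enriched sense: finite conical limits and colimits with their 2-dimensional universal properties, together with cotensors and tensors by the arrow category $\mathbf{2}$) together with a (Quillen) model structure on its underlying ordinary category $\mathcal{K}_0$ such that, for every cofibration $i:A\to B$ and every fibration $p:C\to D$, the induced functor $[i,p]:\mathcal{K}(B,C)\to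 \mathcal{K}(A,C)\times_{\mathcal{K}(A,D)}\mathcal{K}(B,D)$ is an isofibration in $\mathbf{Cat}$, and is moreover an equivalence of categories if either $i$ or $p$ is a weak equivalence. A trivial fibration is a fibration which is a weak equivalence. *)

(* Defs.v *)
From Stdlib Require Import List FinFun ProofIrrelevance.

Set Implicit Arguments.
Unset Strict Implicit.
Unset Printing Implicit Defensive.

Declare Scope cat_scope.
Delimit Scope cat_scope with cat.
Local Open Scope cat_scope.

Reserved Notation "x ~> y" (at level 70, no associativity).
Reserved Notation "g ∘ f" (at level 40, left associativity).
Reserved Notation "f ≡ g" (at level 70, no associativity).
Reserved Notation "g · f" (at level 40, left associativity).
Reserved Notation "b ⋆ a" (at level 40, left associativity).
Reserved Notation "g ◁ a" (at level 40, left associativity).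
Reserved Notation "b ▷ f" (at level 40, left associativity).
Reserved Notation "x ≅ y" (at level 70, no associativity).

(** * Ordinary categories *)

Record Category : Type := {
  obj :> Type;
  arr : obj -> obj -> Type;
  idc : forall x, arr x x;
  compc : forall x y z, arr y z -> arr x y -> arr x z;
  compc_assoc : forall x y z w (h : arr z w) (g : arr y z) (f : arr x y),
      compc h (compc g f) = compc (compc h g) f;
  compc_idl : forall x y (f : arr x y), compc (idc y) f = f;
  compc_idr : forall x y (f : arr x y), compc f (idc x) = f
}.

Arguments arr {c} x y.
Arguments idc {c} x.
Arguments compc {c x y z} g f.

Notation "x ~> y" := (arr x y) : cat_scope.
Notation "g ∘ f" := (compc g f) : cat_scope.

(** Equality of arrows whose endpoints are not syntactically the same:
    [f ≡ g] holds iff the sources are equal, the targets are equal, and the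
    arrows are equal along these equalities. *)
Inductive arr_eq (C : Category) (x y : C) (f : x ~> y) :
    forall x' y' : C, x' ~> y' -> Prop :=
  arr_eq_refl : arr_eq f f.

Notation "f ≡ g" := (arr_eq f g) : cat_scope.

Lemma arr_eq_of_eq (C : Category) (x y : C) (f g : x ~> y) : f = g -> f ≡ g.
Proof. intros []; constructor. Qed.

Lemma arr_eq_sym (C : Category) (x y x' y' : C) (f : x ~> y) (g : x' ~> y') :
  f ≡ g -> g ≡ f.
Proof. intros []; constructor. Qed.

Lemma arr_eq_comp (C : Category) (x y z x' y' z' : C)
    (g : y ~> z) (f : x ~> y) (g' : y' ~> z') (f' : x' ~> y') :
  g ≡ g' -> f ≡ f' -> g ∘ f ≡ g' ∘ f'.
Proof.
  intros Hg; revert f f'; destruct Hg; intros f f' Hf.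
  enough (H : forall y0 (e : y0 = y) (f0 : x' ~> y0),
             f ≡ f0 -> g ∘ f ≡ g ∘ eq_rect y0 (fun t => x' ~> t) f0 y e)
    by exact (H y eq_refl f' Hf).
  intros y0 e f0 H; destruct H.
  rewrite (proof_irrelevance _ e eq_refl); constructor.
Qed.

Definition is_iso (C : Category) (x y : C) (f : x ~> y) : Prop :=
  exists g : y ~> x, g ∘ f = idc x /\ f ∘ g = idc y.

Definition isomorphic (C : Category) (x y : C) : Prop :=
  exists f : x ~> y, is_iso f.

Notation "x ≅ y" := (isomorphic x y) : cat_scope.

Record Functor (C D : Category) : Type := {
  fob :> C -> D;
  fmap : forall x y : C, x ~> y -> fob x ~> fob y;
  fmap_id : forall x : C, fmap (idc x) = idc (fob x);
  fmap_comp : forall (x y z : C) (g : y ~> z) (f : x ~> y),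
      fmap (g ∘ f) = fmap g ∘ fmap f
}.

Arguments fmap {C D} F {x y} _ : rename.

Definition functor_id (C : Category) : Functor C C :=
  {| fob := fun x : C => x;
     fmap := fun (x y : C) (f : x ~> y) => f;
     fmap_id := fun x => eq_refl;
     fmap_comp := fun x y z g f => eq_refl |}.

Program Definition functor_comp (C D E : Category)
    (G : Functor D E) (F : Functor C D) : Functor C E :=
  {| fob := fun x => G (F x);
     fmap := fun x y f => fmap G (fmap F f) |}.
Next Obligation. intros; cbn; now rewrite !fmap_id. Qed.
Next Obligation. intros; cbn; now rewrite !fmap_comp. Qed.

Definition nat_isomorphic (C D : Category) (F G : Functor C D) : Prop :=
  exists t : forall x : C, F x ~> G x,
    (forall (x y : C) (f : x ~> y), t y ∘ fmap F f = fmap G f ∘ t x) /\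
    (forall x : C, is_iso (t x)).

Definition equivalence_of_categories (C D : Category) (F : Functor C D) : Prop :=
  exists G : Functor D C,
    nat_isomorphic (functor_comp G F) (functor_id C) /\
    nat_isomorphic (functor_comp F G) (functor_id D).

(** The equation [fmap p u ≡ v] includes [p e' = b]. *)
Definition isofibration_of_categories (E B : Category) (p : Functor E B) : Prop :=
  forall (e : E) (b : B) (v : b ~> p e), is_iso v ->
    exists (e' : E) (u : e' ~> e), is_iso u /\ fmap p u ≡ v.

(** The strict pullback in [Cat] of a cospan of functors. *)
Section Pullback.
Variables (C D E : Category) (F : Functor C E) (G : Functor D E).

Record pb_obj : Type := {
  pb_fst : C;
  pb_snd : D;
  pb_eq : F pb_fst = G pb_snd
}.

Record pb_arr (x y : pb_obj) : Type := {
  pb_arr_fst : pb_fst x ~> pb_fst y;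
  pb_arr_snd : pb_snd x ~> pb_snd y;
  pb_arr_eq : fmap F pb_arr_fst ≡ fmap G pb_arr_snd
}.

Lemma pb_arr_ext (x y : pb_obj) (f g : pb_arr x y) :
  pb_arr_fst f = pb_arr_fst g -> pb_arr_snd f = pb_arr_snd g -> f = g.
Proof.
  destruct f as [f1 f2 ef], g as [g1 g2 eg]; cbn; intros -> ->.
  now rewrite (proof_irrelevance _ ef eg).
Qed.

Lemma pb_id_eq (x : pb_obj) :
  fmap F (idc (pb_fst x)) ≡ fmap G (idc (pb_snd x)).
Proof. rewrite !fmap_id, pb_eq; constructor. Qed.

Lemma pb_comp_eq (x y z : pb_obj) (g : pb_arr y z) (f : pb_arr x y) :
  fmap F (pb_arr_fst g ∘ pb_arr_fst f) ≡ fmap G (pb_arr_snd g ∘ pb_arr_snd f).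
Proof.
  rewrite !fmap_comp; apply arr_eq_comp; apply pb_arr_eq.
Qed.

Program Definition pullback_category : Category :=
  {| obj := pb_obj;
     arr := pb_arr;
     idc := fun x => {| pb_arr_fst := idc (pb_fst x);
                        pb_arr_snd := idc (pb_snd x);
                        pb_arr_eq := pb_id_eq x |};
     compc := fun x y z g f =>
       {| pb_arr_fst := pb_arr_fst g ∘ pb_arr_fst f;
          pb_arr_snd := pb_arr_snd g ∘ pb_arr_snd f;
          pb_arr_eq := pb_comp_eq g f |} |}.
Next Obligation. intros; apply pb_arr_ext; apply compc_assoc. Qed.
Next Obligation. intros; apply pb_arr_ext; apply compc_idl. Qed.
Next Obligation. intros; apply pb_arr_ext; apply compc_idr. Qed.

End Pullback.

(** * Model structures on an ordinary category *)

Definition mor_class (C : Category) : Type := forall x y : C, x ~> y -> Prop.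

Section Model.
Variable C : Category.

Definition has_lifting (a b c d : C) (i : a ~> b) (p : c ~> d) : Prop :=
  forall (u : a ~> c) (v : b ~> d), p ∘ u = v ∘ i ->
    exists h : b ~> c, h ∘ i = u /\ p ∘ h = v.

Definition llp (R : mor_class C) : mor_class C :=
  fun a b i => forall (c d : C) (p : c ~> d), R c d p -> has_lifting i p.

Definition class_inter (P Q : mor_class C) : mor_class C :=
  fun x y f => P x y f /\ Q x y f.

Definition retract_of (a b c d : C) (f : a ~> b) (g : c ~> d) : Prop :=
  exists (s : a ~> c) (r : c ~> a) (s' : b ~> d) (r' : d ~> b),
    r ∘ s = idc a /\ r' ∘ s' = idc b /\ g ∘ s = s' ∘ f /\ f ∘ r = r' ∘ g.

Definition closed_under_retracts (P : mor_class C) : Prop :=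
  forall (a b c d : C) (f : a ~> b) (g : c ~> d),
    retract_of f g -> P c d g -> P a b f.

Definition has_factorizations (L R : mor_class C) : Prop :=
  forall (x y : C) (f : x ~> y),
    exists (z : C) (l : x ~> z) (r : z ~> y), r ∘ l = f /\ L x z l /\ R z y r.

(** Finite limits and colimits are not included here; they are part of
    [model_Cat_category] below. *)
Record model_structure (W Cof Fib : mor_class C) : Prop := {
  ms_comp : forall (x y z : C) (g : y ~> z) (f : x ~> y),
      W x y f -> W y z g -> W x z (g ∘ f);
  ms_cancel_l : forall (x y z : C) (g : y ~> z) (f : x ~> y),
      W y z g -> W x z (g ∘ f) -> W x y f;
  ms_cancel_r : forall (x y z : C) (g : y ~> z) (f : x ~> y),
      W x y f -> W x z (g ∘ f) -> W y z g;
  ms_retract_W : closed_under_retracts W;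
  ms_retract_Cof : closed_under_retracts Cof;
  ms_retract_Fib : closed_under_retracts Fib;
  ms_lift_trivial_fib : forall (a b c d : C) (i : a ~> b) (p : c ~> d),
      Cof a b i -> class_inter Fib W p -> has_lifting i p;
  ms_lift_trivial_cof : forall (a b c d : C) (i : a ~> b) (p : c ~> d),
      class_inter Cof W i -> Fib c d p -> has_lifting i p;
  ms_fact_trivial_fib : has_factorizations Cof (class_inter Fib W);
  ms_fact_trivial_cof : has_factorizations (class_inter Cof W) Fib
}.

(** A section of the composition functor from composable pairs to arrows. *)
Record functorial_factorization : Type := {
  ff_mid : forall x y : C, x ~> y -> C;
  ff_left : forall (x y : C) (f : x ~> y), x ~> ff_mid f;
  ff_right : forall (x y : C) (f : x ~> y), ff_mid f ~> y;
  ff_fact : forall (x y : C) (f : x ~> y), ff_right f ∘ ff_left f = f;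
  ff_map : forall (x y x' y' : C) (f : x ~> y) (f' : x' ~> y')
      (u : x ~> x') (v : y ~> y'), v ∘ f = f' ∘ u -> ff_mid f ~> ff_mid f';
  ff_map_left : forall (x y x' y' : C) (f : x ~> y) (f' : x' ~> y')
      (u : x ~> x') (v : y ~> y') (sq : v ∘ f = f' ∘ u),
      ff_map sq ∘ ff_left f = ff_left f' ∘ u;
  ff_map_right : forall (x y x' y' : C) (f : x ~> y) (f' : x' ~> y')
      (u : x ~> x') (v : y ~> y') (sq : v ∘ f = f' ∘ u),
      ff_right f' ∘ ff_map sq = v ∘ ff_right f;
  ff_map_id : forall (x y : C) (f : x ~> y) (sq : idc y ∘ f = f ∘ idc x),
      ff_map sq = idc (ff_mid f);
  ff_map_comp : forall (x y x' y' x'' y'' : C)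
      (f : x ~> y) (f' : x' ~> y') (f'' : x'' ~> y'')
      (u : x ~> x') (v : y ~> y') (u' : x' ~> x'') (v' : y' ~> y'')
      (sq : v ∘ f = f' ∘ u) (sq' : v' ∘ f' = f'' ∘ u')
      (sq'' : (v' ∘ v) ∘ f = f'' ∘ (u' ∘ u)),
      ff_map sq'' = ff_map sq' ∘ ff_map sq
}.

Definition has_functorial_factorizations (L R : mor_class C) : Prop :=
  exists F : functorial_factorization,
    forall (x y : C) (f : x ~> y), L _ _ (ff_left F f) /\ R _ _ (ff_right F f).

Definition is_terminal (t : C) : Prop := forall x : C, exists! f : x ~> t, True.
Definition is_initial (t : C) : Prop := forall x : C, exists! f : t ~> x, True.

Definition is_fibrant (Fib : mor_class C) (x : C) : Prop :=
  exists (t : C) (f : x ~> t), is_terminal t /\ Fib x t f.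

Definition is_cofibrant (Cof : mor_class C) (x : C) : Prop :=
  exists (t : C) (f : t ~> x), is_initial t /\ Cof t x f.

End Model.

(** * Strict 2-categories, as [Cat]-enriched categories *)

(** 1-cells [A -> B] are the objects of [hom A B], 2-cells its arrows, and
    vertical composition is composition in [hom A B].  The fields [hcomp] to
    [hcomp2_comp] say that horizontal composition is a functor
    [hom B C * hom A B -> hom A C]; the remaining ones are associativity and
    the unit laws, on 1-cells and on 2-cells. *)
Record TwoCategory : Type := {
  ob :> Type;
  hom : ob -> ob -> Category;
  one : forall A, hom A A;
  hcomp : forall A B C, hom B C -> hom A B -> hom A C;
  hcomp2 : forall A B C (g g' : hom B C) (f f' : hom A B),
      g ~> g' -> f ~> f' -> hcomp g f ~> hcomp g' f';
  hcomp2_id : forall A B C (g : hom B C) (f : hom A B),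
      hcomp2 (idc g) (idc f) = idc (hcomp g f);
  hcomp2_comp : forall A B C (g g' g'' : hom B C) (f f' f'' : hom A B)
      (b' : g' ~> g'') (b : g ~> g') (a' : f' ~> f'') (a : f ~> f'),
      hcomp2 (b' ∘ b) (a' ∘ a) = hcomp2 b' a' ∘ hcomp2 b a;
  hcomp_assoc : forall A B C D (h : hom C D) (g : hom B C) (f : hom A B),
      hcomp h (hcomp g f) = hcomp (hcomp h g) f;
  hcomp2_assoc : forall A B C D (h h' : hom C D) (g g' : hom B C)
      (f f' : hom A B) (c : h ~> h') (b : g ~> g') (a : f ~> f'),
      hcomp2 c (hcomp2 b a) ≡ hcomp2 (hcomp2 c b) a;
  hcomp_onel : forall A B (f : hom A B), hcomp (one B) f = f;
  hcomp2_onel : forall A B (f f' : hom A B) (a : f ~> f'),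
      hcomp2 (idc (one B)) a ≡ a;
  hcomp_oner : forall A B (f : hom A B), hcomp f (one A) = f;
  hcomp2_oner : forall A B (f f' : hom A B) (a : f ~> f'),
      hcomp2 a (idc (one A)) ≡ a
}.

Arguments hom {t} A B.
Arguments one {t} A.
Arguments hcomp {t A B C} g f.
Arguments hcomp2 {t A B C g g' f f'} b a.

Notation "g · f" := (hcomp g f) : cat_scope.
Notation "b ⋆ a" := (hcomp2 b a) : cat_scope.
Notation "g ◁ a" := (hcomp2 (idc g) a) : cat_scope.
Notation "b ▷ f" := (hcomp2 b (idc f)) : cat_scope.

Definition underlying (K : TwoCategory) : Category :=
  {| obj := K;
     arr := fun A B : K => obj (hom A B);
     idc := fun A : K => one A;
     compc := fun (A B C : K) (g : hom B C) (f : hom A B) => g · f;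
     compc_assoc := @hcomp_assoc K;
     compc_idl := @hcomp_onel K;
     compc_idr := @hcomp_oner K |}.

(** [op K] reverses the 1-cells of [K] but not its 2-cells. *)
Definition op (K : TwoCategory) : TwoCategory :=
  {| ob := K;
     hom := fun A B : K => hom B A;
     one := fun A : K => one A;
     hcomp := fun (A B C : K) (g : hom C B) (f : hom B A) => f · g;
     hcomp2 := fun (A B C : K) (g g' : hom C B) (f f' : hom B A)
                   (b : g ~> g') (a : f ~> f') => a ⋆ b;
     hcomp2_id := fun A B C g f => hcomp2_id f g;
     hcomp2_comp := fun A B C g g' g'' f f' f'' b' b a' a =>
                      hcomp2_comp a' a b' b;
     hcomp_assoc := fun A B C D h g f => eq_sym (hcomp_assoc f g h);
     hcomp2_assoc := fun A B C D h h' g g' f f' c b a =>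
                       arr_eq_sym (hcomp2_assoc a b c);
     hcomp_onel := fun A B f => hcomp_oner f;
     hcomp2_onel := fun A B f f' a => hcomp2_oner a;
     hcomp_oner := fun A B f => hcomp_onel f;
     hcomp2_oner := fun A B f f' a => hcomp2_onel a |}.

(** ** Finite limits and colimits *)

Section Limits.
Variable K : TwoCategory.

Record Cone (J : Category) (D : Functor J (underlying K)) (X : K) : Type := {
  leg :> forall j : J, hom X (D j);
  leg_comm : forall (j k : J) (u : j ~> k),
      (fmap D u : hom (D j) (D k)) · leg j = leg k
}.

(** Composition with the cone [L] is an isomorphism from the category
    [hom X P] to the category of cones on [D] with vertex [X]. *)
Definition is_limit (J : Category) (D : Functor J (underlying K))
    (P : K) (L : Cone D P) : Prop :=
  (forall (X : K) (M : Cone D X), exists! h : hom X P, forall j : J, L j · h = M j)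
  /\
  (forall (X : K) (h h' : hom X P) (m : forall j : J, L j · h ~> L j · h'),
      (forall (j k : J) (u : j ~> k),
          (fmap D u : hom (D j) (D k)) ◁ m j ≡ m k) ->
      exists! a : h ~> h', forall j : J, L j ◁ a = m j).

Definition finite_category (J : Category) : Prop :=
  Finite J /\ forall j k : J, Finite (j ~> k).

Definition has_finite_conical_limits : Prop :=
  forall (J : Category) (D : Functor J (underlying K)), finite_category J ->
    exists (P : K) (L : Cone D P), is_limit L.

(** Composition with [l] is an isomorphism from the category [hom X P] to the
    category of functors from the arrow category [0 -> 1] to [hom X A], whose
    objects are the arrows of [hom X A] and whose arrows are the commutative
    squares. *)
Definition is_arrow_cotensor (A P : K) (s t : hom P A) (l : s ~> t) : Prop :=
  (forall (X : K) (f g : hom X A) (q : f ~> g), exists! h : hom X P, l ▷ h ≡ q)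
  /\
  (forall (X : K) (h h' : hom X P) (a : s · h ~> s · h') (b : t · h ~> t · h'),
      b ∘ (l ▷ h) = (l ▷ h') ∘ a ->
      exists! c : h ~> h', s ◁ c = a /\ t ◁ c = b).

Definition has_arrow_cotensors : Prop :=
  forall A : K, exists (P : K) (s t : hom P A) (l : s ~> t),
    is_arrow_cotensor l.

Definition has_finite_limits : Prop :=
  has_finite_conical_limits /\ has_arrow_cotensors.

End Limits.

(** Colimits and tensors in [K] are limits and cotensors in [op K]. *)
Definition has_finite_colimits (K : TwoCategory) : Prop :=
  has_finite_limits (op K).

(** ** Equivalences and isofibrations in a 2-category *)

Section Classes.
Variable K : TwoCategory.

Definition is_equivalence : mor_class (underlying K) :=
  fun (A B : K) (f : hom A B) =>
    exists g : hom B A, g · f ≅ one A /\ f · g ≅ one B.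

(** The equation [f ◁ a ≡ b] includes [f · x' = y]. *)
Definition is_isofibration : mor_class (underlying K) :=
  fun (A B : K) (f : hom A B) =>
    forall (X : K) (x : hom X A) (y : hom X B) (b : y ~> f · x), is_iso b ->
      exists (x' : hom X A) (a : x' ~> x), is_iso a /\ f ◁ a ≡ b.

Definition is_trivial_fibration : mor_class (underlying K) :=
  class_inter is_isofibration is_equivalence.

Definition is_cofibration : mor_class (underlying K) := llp is_trivial_fibration.

End Classes.

(** ** Model [Cat]-categories *)

Section ModelCat.
Variable K : TwoCategory.

Program Definition postcomp (X A B : K) (p : hom A B) :
    Functor (hom X A) (hom X B) :=
  {| fob := fun f => p · f;
     fmap := fun f f' a => p ◁ a |}.
Next Obligation. intros; apply hcomp2_id. Qed.
Next Obligation. intros; rewrite <- hcomp2_comp, compc_idl; reflexivity. Qed.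

Program Definition precomp (X A B : K) (i : hom A B) :
    Functor (hom B X) (hom A X) :=
  {| fob := fun f => f · i;
     fmap := fun f f' a => a ▷ i |}.
Next Obligation. intros; apply hcomp2_id. Qed.
Next Obligation. intros; rewrite <- hcomp2_comp, compc_idl; reflexivity. Qed.

(** The functor
    [i, p] : K(B, C) -> K(A, C) x_{K(A, D)} K(B, D),  h |-> (h i, p h). *)
Program Definition leibniz_hom (A B C D : K) (i : hom A B) (p : hom C D) :
    Functor (hom B C) (pullback_category (postcomp A p) (precomp D i)) :=
  {| fob := fun h => {| pb_fst := h · i;
                        pb_snd := p · h;
                        pb_eq := hcomp_assoc p h i |};
     fmap := fun h h' a => {| pb_arr_fst := a ▷ i;
                              pb_arr_snd := p ◁ a;
                              pb_arr_eq := hcomp2_assoc (idc p) a (idc i) |} |}.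
Next Obligation. intros; apply pb_arr_ext; apply hcomp2_id. Qed.
Next Obligation.
  intros; apply pb_arr_ext; cbn; rewrite <- hcomp2_comp, compc_idl; reflexivity.
Qed.

Record model_Cat_category (W Cof Fib : mor_class (underlying K)) : Prop := {
  mcc_limits : has_finite_limits K;
  mcc_colimits : has_finite_colimits K;
  mcc_model : model_structure W Cof Fib;
  mcc_isofibration : forall (A B C D : K) (i : hom A B) (p : hom C D),
      Cof A B i -> Fib C D p -> isofibration_of_categories (leibniz_hom i p);
  mcc_equivalence : forall (A B C D : K) (i : hom A B) (p : hom C D),
      Cof A B i -> Fib C D p -> W A B i \/ W C D p ->
      equivalence_of_categories (leibniz_hom i p)
}.

End ModelCat.

(* Main.v *)
(** A 1-cell is a trivial fibration iff, for every [X], postcomposition with it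
    on [hom X -] is surjective on objects and fully faithful.  For [p : C -> D]
    let [P] be the universal object with an invertible 2-cell [d ≅ p · c],
    [c : P -> C], [d : P -> D].  The projection [c] is a trivial fibration with
    a section [i] such that [p = d · i], where [i] is an equivalence and [d] an
    isofibration.  The same object taken in [op K] is the mapping cylinder of
    [p]; lifting against trivial fibrations shows that it factors [p] as a
    cofibration followed by a trivial fibration.  Composing the two
    factorizations gives the one into a trivial cofibration and a fibration.

    For an isofibration [p], the object of invertible 2-cells of [C] maps to
    [P] by a trivial fibration, so lifting a cofibration [i] against this map
    says that [leibniz_hom i p] is an isofibration of categories.  If [i] is
    moreover an equivalence with inverse [g], then a square [(u, v)] from [i]
    to [p] is filled by applying this to [u · g]. *)
From Stdlib Require Import List FinFun ProofIrrelevance ClassicalEpsilon.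
Require Import Defs.

Set Implicit Arguments.
Unset Strict Implicit.
Unset Printing Implicit Defensive.
Local Open Scope cat_scope.

(** Source and target are fields, so that [hc] below is associative up to [=]. *)
Record cell (C : Category) : Type := Cell { src : C; tgt : C; mor : src ~> tgt }.
Arguments Cell {C src tgt} mor.

Reserved Notation "b • a" (at level 40, left associativity).
Reserved Notation "b ** a" (at level 37, right associativity).

(** * 2-cells without fixed endpoints *)

Section Cells.
Variable C : Category.
Implicit Types (a b c : cell C) (x y z : C).

Definition cid x : cell C := Cell (idc x).

Lemma cell_eq x y x' y' (f : x ~> y) (g : x' ~> y') : f ≡ g -> Cell f = Cell g.
Proof. now intros []. Qed.

Lemma arr_eq_cell x y x' y' (f : x ~> y) (g : x' ~> y') : Cell f = Cell g -> f ≡ g.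
Proof.
  intros H.
  change (mor (Cell f) ≡ mor (Cell g)).
  rewrite H; constructor.
Qed.

(** Passing to cells loses nothing between fixed endpoints. The endpoints of [g] are generalised,
    and proof irrelevance then removes the transports. *)
Lemma cell_inj x y (f g : x ~> y) : Cell f = Cell g -> f = g.
Proof.
  intros H; apply arr_eq_cell in H.
  enough (G : forall x' y' (g' : x' ~> y'), f ≡ g' ->
      forall (ex : x' = x) (ey : y' = y),
        f = eq_rect _ (fun t => t ~> y) (eq_rect _ (fun t => x' ~> t) g' _ ey) _ ex)
    by exact (G x y g H eq_refl eq_refl).
  intros x' y' g' [] ex ey.
  now rewrite (proof_irrelevance _ ex eq_refl), (proof_irrelevance _ ey eq_refl).
Qed.

Lemma cid_inj x y : cid x = cid y -> x = y.
Proof. intros H; exact (f_equal (@src C) H). Qed.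

(** The value at a non-composable pair is junk. *)
Definition vc b a : cell C :=
  match excluded_middle_informative (tgt a = src b) with
  | left e => Cell (mor b ∘ eq_rect _ (fun t => src a ~> t) (mor a) _ e)
  | right _ => a
  end.
Local Notation "b • a" := (vc b a).

Lemma vc_mor x y z (g : y ~> z) (f : x ~> y) : Cell g • Cell f = Cell (g ∘ f).
Proof.
  unfold vc; cbn; destruct excluded_middle_informative as [e|n]; [|now destruct n].
  now rewrite (proof_irrelevance _ e eq_refl).
Qed.

Lemma vc_src a b : tgt a = src b -> src (b • a) = src a.
Proof. destruct a, b; cbn; intros ->; now rewrite vc_mor. Qed.

Lemma vc_tgt a b : tgt a = src b -> tgt (b • a) = tgt b.
Proof. destruct a, b; cbn; intros ->; now rewrite vc_mor. Qed.

Lemma vc_assoc a b c : tgt a = src b -> tgt b = src c -> c • (b • a) = (c • b) • a.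
Proof.
  destruct a, b, c; cbn; intros -> ->; now rewrite !vc_mor, compc_assoc.
Qed.

Lemma vc_idl a x : tgt a = x -> cid x • a = a.
Proof. destruct a; cbn; intros ->; unfold cid; now rewrite vc_mor, compc_idl. Qed.

Lemma vc_idr a x : src a = x -> a • cid x = a.
Proof. destruct a; cbn; intros <-; unfold cid; now rewrite vc_mor, compc_idr. Qed.

(** The two endpoint equations are required because [vc] is meaningful only on composable pairs. *)
Definition inverse_cells a b : Prop :=
  tgt a = src b /\ tgt b = src a /\ b • a = cid (src a) /\ a • b = cid (src b).

Definition ciso a : Prop := is_iso (mor a).

Lemma ciso_inverse a : ciso a -> exists b, inverse_cells a b.
Proof.
  destruct a as [x y f]; intros [g [e1 e2]]; cbn in *.
  exists (Cell g); unfold inverse_cells; cbn.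
  rewrite !vc_mor, e1, e2; auto.
Qed.

Lemma inverse_ciso a b : inverse_cells a b -> ciso a.
Proof.
  destruct a as [x y f], b as [x' y' g]; intros [e1 [e2 [e3 e4]]]; cbn in *.
  subst x' y'; rewrite !vc_mor in *.
  exists g; split; apply cell_inj; assumption.
Qed.

Lemma ciso_cid x : ciso (cid x).
Proof. exists (idc x); split; apply compc_idl. Qed.

Lemma vc_cancel_l a b b' c : inverse_cells a c ->
  tgt b = src a -> tgt b' = src a -> a • b = a • b' -> b = b'.
Proof.
  intros [e1 [e2 [e3 e4]]] h h' H.
  rewrite <- (vc_idl h), <- (vc_idl h'), <- e3, <- !vc_assoc by congruence.
  now rewrite H.
Qed.

Lemma vc_cancel_r a b b' c : inverse_cells a c ->
  src b = tgt a -> src b' = tgt a -> b • a = b' • a -> b = b'.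
Proof.
  intros [e1 [e2 [e3 e4]]] h h' H.
  rewrite <- (vc_idr h), <- (vc_idr h'), e1, <- e4, !vc_assoc by congruence.
  now rewrite H.
Qed.

Lemma ciso_vc a b : tgt a = src b -> ciso a -> ciso b -> ciso (b • a).
Proof.
  intros e Ha Hb.
  destruct (ciso_inverse Ha) as [a' [a1 [a2 [a3 a4]]]].
  destruct (ciso_inverse Hb) as [b' [b1 [b2 [b3 b4]]]].
  apply inverse_ciso with (b := a' • b').
  assert (tgt b' = src a') by congruence.
  unfold inverse_cells; rewrite !vc_src, !vc_tgt by congruence.
  repeat split; try congruence.
  - rewrite <- (vc_assoc (a := b • a)), (vc_assoc (a := a)), b3, vc_idl
      by (rewrite ?vc_src, ?vc_tgt; congruence).
    congruence.
  - rewrite <- (vc_assoc (a := a' • b')), (vc_assoc (a := b')), a4, vc_idl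
      by (rewrite ?vc_src, ?vc_tgt; congruence).
    congruence.
Qed.

Lemma inverse_unique a b b' : inverse_cells a b -> inverse_cells a b' -> b = b'.
Proof.
  intros H H'; apply (vc_cancel_r H); firstorder congruence.
Qed.

Lemma isomorphic_cell x y : x ≅ y <-> exists a, ciso a /\ src a = x /\ tgt a = y.
Proof.
  split.
  - intros [f Hf]; exists (Cell f); auto.
  - intros [[x' y' f] [Hf [<- <-]]]; exists f; exact Hf.
Qed.

End Cells.

Notation "b • a" := (vc b a) : cat_scope.

(** * Horizontal composition and whiskering *)

Section Horizontal.
Variable K : TwoCategory.

Definition hc (A B C : K) (b : cell (hom B C)) (a : cell (hom A B)) : cell (hom A C) :=
  Cell (mor b ⋆ mor a).
Local Notation "b ** a" := (hc b a).
Local Notation "⌜ f ⌝" := (@cid (hom _ _) f).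

Variables A B C D : K.

Lemma hc_assoc (c : cell (hom C D)) (b : cell (hom B C)) (a : cell (hom A B)) :
  (c ** b) ** a = c ** b ** a.
Proof. symmetry; apply cell_eq, hcomp2_assoc. Qed.

Lemma hc_id (g : hom B C) (f : hom A B) : ⌜g⌝ ** ⌜f⌝ = ⌜g · f⌝.
Proof. apply cell_eq, arr_eq_of_eq, hcomp2_id. Qed.

Lemma hc_onel (a : cell (hom A B)) : ⌜one B⌝ ** a = a.
Proof. destruct a; apply cell_eq, hcomp2_onel. Qed.

Lemma hc_oner (a : cell (hom A B)) : a ** ⌜one A⌝ = a.
Proof. destruct a; apply cell_eq, hcomp2_oner. Qed.

Lemma hc_vc (b b' : cell (hom B C)) (a a' : cell (hom A B)) :
  tgt b = src b' -> tgt a = src a' -> (b' • b) ** (a' • a) = (b' ** a') • (b ** a).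
Proof.
  destruct a, b, a', b'; cbn; intros -> ->; rewrite !vc_mor; unfold hc; cbn [src tgt mor]; rewrite vc_mor.
  apply cell_eq, arr_eq_of_eq, hcomp2_comp.
Qed.

Lemma hc_vc_l (g : hom B C) (a a' : cell (hom A B)) :
  tgt a = src a' -> ⌜g⌝ ** (a' • a) = (⌜g⌝ ** a') • (⌜g⌝ ** a).
Proof. intros e; rewrite <- hc_vc by auto; now rewrite vc_idl. Qed.

Lemma hc_vc_r (b b' : cell (hom B C)) (f : hom A B) :
  tgt b = src b' -> (b' • b) ** ⌜f⌝ = (b' ** ⌜f⌝) • (b ** ⌜f⌝).
Proof. intros e; rewrite <- hc_vc by auto; now rewrite vc_idl. Qed.

Lemma interchange (b : cell (hom B C)) (a : cell (hom A B)) :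
  (⌜tgt b⌝ ** a) • (b ** ⌜src a⌝) = (b ** ⌜tgt a⌝) • (⌜src b⌝ ** a).
Proof. rewrite <- !hc_vc by auto; now rewrite !vc_idl, !vc_idr. Qed.

Lemma inverse_hc (b b' : cell (hom B C)) (a a' : cell (hom A B)) :
  inverse_cells b b' -> inverse_cells a a' -> inverse_cells (b ** a) (b' ** a').
Proof.
  intros [b1 [b2 [b3 b4]]] [a1 [a2 [a3 a4]]].
  unfold inverse_cells; rewrite <- !hc_vc by congruence.
  rewrite b3, b4, a3, a4, !hc_id; cbn; repeat split; congruence.
Qed.

Lemma ciso_hc (b : cell (hom B C)) (a : cell (hom A B)) :
  ciso b -> ciso a -> ciso (b ** a).
Proof.
  intros Hb Ha.
  destruct (ciso_inverse Hb), (ciso_inverse Ha).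
  eapply inverse_ciso, inverse_hc; eassumption.
Qed.

End Horizontal.
Notation "b ** a" := (hc b a) : cat_scope.
Notation "⌜ f ⌝" := (@cid (hom _ _) f) : cat_scope.

(** * Equivalences and isofibrations *)

Section Representable.
Variable K : TwoCategory.

Lemma isofibration_cell (A B : K) (f : hom A B) :
  is_isofibration f <->
  forall (X : K) (x : hom X A) (b : cell (hom X B)), ciso b -> tgt b = f · x ->
    exists a, ciso a /\ tgt a = x /\ ⌜f⌝ ** a = b.
Proof.
  split.
  - intros H X x [y y' b] Hb e; cbn in *; subst y'.
    destruct (H X x y b Hb) as [x' [a [Ha E]]].
    exists (Cell a); repeat split; [exact Ha | apply cell_eq, E].
  - intros H X x y b Hb.
    destruct (H X x (Cell b) Hb eq_refl) as [[x' x'' a] [Ha [e E]]]; cbn in *; subst x''.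
    exists x', a; split; [exact Ha | apply arr_eq_cell, E].
Qed.

Definition faithful (A B : K) (f : hom A B) : Prop :=
  forall (X : K) (a a' : cell (hom X A)),
    src a = src a' -> tgt a = tgt a' -> ⌜f⌝ ** a = ⌜f⌝ ** a' -> a = a'.

Definition full (A B : K) (f : hom A B) : Prop :=
  forall (X : K) (x x' : hom X A) (b : cell (hom X B)),
    src b = f · x -> tgt b = f · x' ->
    exists a, src a = x /\ tgt a = x' /\ ⌜f⌝ ** a = b.

Definition surjective (A B : K) (f : hom A B) : Prop :=
  forall (X : K) (y : hom X B), exists x, f · x = y.

(** Naturality of [eta : g f => 1] at [c], an instance of interchange. When [eta] is invertible, it
    recovers [c] from its image under [f]. *)
Lemma retraction_natural (A B X : K) (f : hom A B) (g : hom B A)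
    (eta : cell (hom A A)) (es : src eta = g · f) (et : tgt eta = one A)
    (c : cell (hom X A)) :
  c • (eta ** ⌜src c⌝) = (eta ** ⌜tgt c⌝) • (⌜g⌝ ** ⌜f⌝ ** c).
Proof.
  rewrite <- hc_assoc, hc_id, <- es, <- interchange, et.
  now rewrite hc_onel.
Qed.

Lemma faithful_retraction_iso (A B : K) (f : hom A B) (g : hom B A)
    (eta : cell (hom A A)) :
  ciso eta -> src eta = g · f -> tgt eta = one A -> faithful f.
Proof.
  intros H es et X a a' e1 e2 E.
  destruct (ciso_inverse H) as [eta' Hi].
  pose proof (retraction_natural (X := X) es et) as Hn.
  assert (Hs : inverse_cells (eta ** ⌜src a⌝) (eta' ** ⌜src a⌝)).
  { apply inverse_hc; [exact Hi|]. unfold inverse_cells; cbn.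
    rewrite !vc_idl; auto. }
  apply (vc_cancel_r Hs).
  - cbn; now rewrite et, hcomp_onel.
  - cbn; now rewrite et, hcomp_onel.
  - rewrite e1 at 2; rewrite !Hn; congruence.
Qed.

Lemma equivalence_faithful (A B : K) (f : hom A B) : is_equivalence f -> faithful f.
Proof.
  intros [g [H _]]; apply isomorphic_cell in H; destruct H as [eta [H1 [H2 H3]]].
  eapply faithful_retraction_iso; eassumption.
Qed.

(** The lift of [b] is [g b] conjugated by [eta]. That [f] sends it to [b] is tested after applying
    [g], which is an equivalence too and hence faithful. *)
Lemma equivalence_full (A B : K) (f : hom A B) : is_equivalence f -> full f.
Proof.
  intros [g [H H']] X x x' b es et.
  assert (Hg : faithful g) by (apply equivalence_faithful; now exists f).
  apply isomorphic_cell in H; destruct H as [eta [Hi [e1 e2]]].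
  destruct (ciso_inverse Hi) as [eta' [i1 [i2 [i3 i4]]]].
  assert (j1 : forall y, src (eta' ** ⌜y⌝) = y :> hom X A)
    by (intros; cbn; rewrite <- i1, e2; apply hcomp_onel).
  assert (j2 : forall y, tgt (eta' ** ⌜y⌝) = g · (f · y) :> hom X A)
    by (intros; cbn; rewrite i2, e1; now rewrite hcomp_assoc).
  assert (j3 : forall y, tgt (eta ** ⌜y⌝) = y :> hom X A)
    by (intros; cbn; rewrite e2; apply hcomp_onel).
  assert (j4 : forall y, src (eta ** ⌜y⌝) = g · (f · y) :> hom X A)
    by (intros; cbn; rewrite e1; now rewrite hcomp_assoc).
  assert (s1 : tgt (eta' ** ⌜x⌝) = src (⌜g⌝ ** b)) by (rewrite j2; cbn; congruence).
  assert (s2 : tgt (⌜g⌝ ** b) = src (eta ** ⌜x'⌝)) by (rewrite j4; cbn; congruence).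
  assert (s3 : tgt ((⌜g⌝ ** b) • (eta' ** ⌜x⌝)) = src (eta ** ⌜x'⌝))
    by now rewrite vc_tgt.
  exists ((eta ** ⌜x'⌝) • ((⌜g⌝ ** b) • (eta' ** ⌜x⌝))).
  assert (t1 : src ((eta ** ⌜x'⌝) • ((⌜g⌝ ** b) • (eta' ** ⌜x⌝))) = x)
    by now rewrite !vc_src.
  assert (t2 : tgt ((eta ** ⌜x'⌝) • ((⌜g⌝ ** b) • (eta' ** ⌜x⌝))) = x')
    by now rewrite vc_tgt.
  repeat split; [exact t1 | exact t2 |].
  set (a := (eta ** ⌜x'⌝) • ((⌜g⌝ ** b) • (eta' ** ⌜x⌝))) in *.
  apply Hg; [cbn; congruence | cbn; congruence |].
  (* naturality of [eta] at [a] identifies [g f a] with [g b] *)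
  assert (N : a • (eta ** ⌜x⌝) = (eta ** ⌜x'⌝) • (⌜g⌝ ** ⌜f⌝ ** a)).
  { pose proof (retraction_natural e1 e2 a) as N; now rewrite t1, t2 in N. }
  assert (M : a • (eta ** ⌜x⌝) = (eta ** ⌜x'⌝) • (⌜g⌝ ** b)).
  { assert (s4 : tgt (eta ** ⌜x⌝) = src (eta' ** ⌜x⌝)) by now rewrite j1, j3.
    unfold a; rewrite <- (vc_assoc (a := eta ** ⌜x⌝)) by (rewrite ?vc_src; auto).
    rewrite <- (vc_assoc (a := eta ** ⌜x⌝)) by auto.
    rewrite <- hc_vc_r, i3, e1, hc_id, vc_idr; auto.
    cbn; rewrite es; apply hcomp_assoc. }
  assert (I : inverse_cells (eta ** ⌜x'⌝) (eta' ** ⌜x'⌝)).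
  { apply inverse_hc; [repeat split; auto|]. unfold inverse_cells; cbn.
    rewrite !vc_idl; auto. }
  apply (vc_cancel_l I).
  - cbn; rewrite t2, e1; apply hcomp_assoc.
  - exact s2.
  - congruence.
Qed.

(** The equivalence gives [g · y] as a preimage of [y] up to the isomorphism [e]. Lifting the
    inverse of [e] along the isofibration corrects it to a strict preimage. *)
Lemma trivial_fibration_surjective (A B : K) (f : hom A B) :
  is_trivial_fibration f -> surjective f.
Proof.
  intros [Hf [g [_ H]]] X y.
  apply isomorphic_cell in H; destruct H as [e [He [e1 e2]]].
  destruct (ciso_inverse He) as [e' [i1 [i2 [i3 i4]]]].
  destruct (proj1 (isofibration_cell f) Hf X (g · y) (e' ** ⌜y⌝)) as [a [_ [_ E]]].
  - apply ciso_hc; [|apply ciso_cid]. apply inverse_ciso with e; repeat split; auto.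
  - cbn; rewrite i2, e1; now rewrite hcomp_assoc.
  - exists (src a). apply (f_equal (@src _)) in E; cbn in E.
    now rewrite E, <- i1, e2, hcomp_onel.
Qed.

Lemma full_faithful_ciso (A B : K) (f : hom A B) (X : K) (a : cell (hom X A)) :
  full f -> faithful f -> ciso (⌜f⌝ ** a) -> ciso a.
Proof.
  intros Hf Hf' H; destruct (ciso_inverse H) as [b [i1 [i2 [i3 i4]]]]; cbn in *.
  destruct (Hf X (tgt a) (src a) b) as [a' [e1 [e2 E]]]; try congruence.
  subst b; apply inverse_ciso with a'.
  repeat split; auto; apply Hf'; rewrite ?vc_src, ?vc_tgt; cbn; auto.
  - rewrite hc_vc_l, i3, hc_id; auto.
  - rewrite hc_vc_l, i4, hc_id; auto.
Qed.

(** A 2-cell is lifted by first choosing a strict preimage of its source; fullness and faithfulness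
    make the lift invertible. A preimage of [one B] is a strict section [s], and lifting the
    identity of [f] gives [s · f ≅ one A]. *)
Lemma surjective_full_faithful_trivial_fibration (A B : K) (f : hom A B) :
  surjective f -> full f -> faithful f -> is_trivial_fibration f.
Proof.
  intros Hs Hf Hf'; split.
  - apply isofibration_cell; intros X x b Hb e.
    destruct (Hs X (src b)) as [x' Hx'].
    destruct (Hf X x' x b) as [a [e1 [e2 E]]]; auto.
    exists a; repeat split; auto.
    apply (full_faithful_ciso (f := f)); auto; congruence.
  - destruct (Hs B (one B)) as [s Es]; exists s; split.
    + destruct (Hf A (s · f) (one A) ⌜f⌝) as [a [e1 [e2 E]]]; cbn.
      * now rewrite hcomp_assoc, Es, hcomp_onel.
      * now rewrite hcomp_oner.
      * apply isomorphic_cell; exists a; repeat split; auto.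
        apply (full_faithful_ciso (f := f)); auto; rewrite E; apply ciso_cid.
    + rewrite Es; exists (idc (one B)); apply ciso_cid.
Qed.

Lemma trivial_fibration_full_faithful (A B : K) (f : hom A B) :
  is_trivial_fibration f -> full f /\ faithful f.
Proof.
  intros [_ H]; split; [now apply equivalence_full | now apply equivalence_faithful].
Qed.

Lemma section_equivalence_trivial_fibration (A B : K) (f : hom A B) (s : hom B A) :
  f · s = one B -> is_equivalence f -> is_trivial_fibration f.
Proof.
  intros e H; apply surjective_full_faithful_trivial_fibration.
  - intros X y; exists (s · y); now rewrite hcomp_assoc, e, hcomp_onel.
  - now apply equivalence_full.
  - now apply equivalence_faithful.
Qed.

End Representable.

(** * Two-out-of-three, composition and retracts *)

Section ClassProperties.
Variable K : TwoCategory.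

Lemma isomorphic_refl (C : Category) (x : C) : x ≅ x.
Proof. exists (idc x); apply ciso_cid. Qed.

Lemma isomorphic_trans (C : Category) (x y z : C) : x ≅ y -> y ≅ z -> x ≅ z.
Proof.
  rewrite !isomorphic_cell; intros [a [Ha [a1 a2]]] [b [Hb [b1 b2]]].
  exists (b • a); rewrite vc_src, vc_tgt by congruence.
  repeat split; auto; apply ciso_vc; congruence.
Qed.

Lemma isomorphic_sym (C : Category) (x y : C) : x ≅ y -> y ≅ x.
Proof. intros [f [g [H1 H2]]]; exists g, f; auto. Qed.

Lemma isomorphic_hcomp (A B C : K) (g g' : hom B C) (f f' : hom A B) :
  g ≅ g' -> f ≅ f' -> g · f ≅ g' · f'.
Proof.
  rewrite !isomorphic_cell; intros [a [Ha [<- <-]]] [b [Hb [<- <-]]].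
  exists (a ** b); repeat split; now apply ciso_hc.
Qed.

Lemma isomorphic_conjugate (A B C : K) (g' : hom C B) (g : hom B C)
    (f' : hom B A) (f : hom A B) :
  g' · g ≅ one B -> f' · f ≅ one A -> (f' · g') · (g · f) ≅ one A.
Proof.
  intros Hg Hf; apply isomorphic_trans with (f' · f); [|exact Hf].
  replace ((f' · g') · (g · f)) with (f' · ((g' · g) · f))
    by (now rewrite !hcomp_assoc).
  apply isomorphic_hcomp; [apply isomorphic_refl|].
  rewrite <- (hcomp_onel f) at 2.
  apply isomorphic_hcomp; [exact Hg | apply isomorphic_refl].
Qed.

Lemma equivalence_comp (A B C : K) (g : hom B C) (f : hom A B) :
  is_equivalence f -> is_equivalence g -> is_equivalence (g · f).
Proof.
  intros [f' [Hf Hf']] [g' [Hg Hg']]; exists (f' · g').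
  split; apply isomorphic_conjugate; auto.
Qed.

(** Reduces both cancellation laws to closure under composition: if [g'] is a pseudo-inverse of [g],
    then [f ≅ g' · (g · f)], and dually. *)
Lemma isomorphic_equivalence (A B : K) (f f' : hom A B) :
  f ≅ f' -> is_equivalence f -> is_equivalence f'.
Proof.
  intros H [g [Hg Hg']]; exists g; apply isomorphic_sym in H; split.
  - eapply isomorphic_trans; [|exact Hg].
    apply isomorphic_hcomp; [apply isomorphic_refl | exact H].
  - eapply isomorphic_trans; [|exact Hg'].
    apply isomorphic_hcomp; [exact H | apply isomorphic_refl].
Qed.

Lemma equivalence_cancel_l (A B C : K) (g : hom B C) (f : hom A B) :
  is_equivalence g -> is_equivalence (g · f) -> is_equivalence f.
Proof.
  intros [g' [Hg Hg']] H.
  apply isomorphic_equivalence with (g' · (g · f)).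
  - rewrite hcomp_assoc; rewrite <- (hcomp_onel f) at 2.
    apply isomorphic_hcomp; [exact Hg | apply isomorphic_refl].
  - apply equivalence_comp; [exact H | now exists g].
Qed.

Lemma equivalence_cancel_r (A B C : K) (g : hom B C) (f : hom A B) :
  is_equivalence f -> is_equivalence (g · f) -> is_equivalence g.
Proof.
  intros [f' [Hf Hf']] H.
  apply isomorphic_equivalence with ((g · f) · f').
  - rewrite <- hcomp_assoc. rewrite <- (hcomp_oner g) at 2.
    apply isomorphic_hcomp; [apply isomorphic_refl | exact Hf'].
  - apply equivalence_comp; [now exists f | exact H].
Qed.

Lemma equivalence_retract : closed_under_retracts (@is_equivalence K).
Proof.
  intros A B C D f g [s [r [s' [r' [e1 [e2 [e3 e4]]]]]]] [g' [Hg Hg']]; cbn in *.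
  (* The pseudo-inverse [g'] is carried to the retract: include by [s'], apply [g'], retract by
     [r]. *)
  exists (r · g' · s'); split.
  - rewrite <- hcomp_assoc, <- e3, <- e1.
    replace (r · g' · (g · s)) with (r · ((g' · g) · s)) by now rewrite !hcomp_assoc.
    apply isomorphic_hcomp; [apply isomorphic_refl|].
    rewrite <- (hcomp_onel s) at 2.
    apply isomorphic_hcomp; [exact Hg | apply isomorphic_refl].
  - rewrite !hcomp_assoc, e4, <- e2.
    replace (r' · g · g' · s') with (r' · ((g · g') · s')) by now rewrite !hcomp_assoc.
    apply isomorphic_hcomp; [apply isomorphic_refl|].
    rewrite <- (hcomp_onel s') at 2.
    apply isomorphic_hcomp; [exact Hg' | apply isomorphic_refl].
Qed.

(** Send the 2-cell into the codomain of [g] along [s'], lift it there, and bring the lift back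
    along [r]. *)
Lemma isofibration_retract : closed_under_retracts (@is_isofibration K).
Proof.
  intros A B C D f g [s [r [s' [r' [e1 [e2 [e3 e4]]]]]]] Hg; cbn in *.
  apply isofibration_cell; intros X x b Hb e.
  destruct (proj1 (isofibration_cell g) Hg X (s · x) (⌜s'⌝ ** b)) as [a [Ha [e' E]]].
  - apply ciso_hc; [apply ciso_cid | exact Hb].
  - cbn; now rewrite e, !hcomp_assoc, e3.
  - exists (⌜r⌝ ** a); repeat split.
    + apply ciso_hc; [apply ciso_cid | exact Ha].
    + cbn; now rewrite e', hcomp_assoc, e1, hcomp_onel.
    + now rewrite <- hc_assoc, hc_id, e4, <- hc_id, hc_assoc, E, <- hc_assoc, hc_id,
        e2, hc_onel.
Qed.

Lemma isofibration_comp (A B C : K) (g : hom B C) (f : hom A B) :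
  is_isofibration f -> is_isofibration g -> is_isofibration (g · f).
Proof.
  rewrite !isofibration_cell; intros Hf Hg X x c Hc e.
  destruct (Hg X (f · x) c Hc) as [b [Hb [eb Eb]]]; [now rewrite hcomp_assoc|].
  destruct (Hf X x b Hb eb) as [a [Ha [ea Ea]]].
  exists a; repeat split; auto; now rewrite <- hc_id, hc_assoc, Ea.
Qed.

Lemma llp_retract (C : Category) (R : mor_class C) : closed_under_retracts (llp R).
Proof.
  intros a b c d f g [s [r [s' [r' [e1 [e2 [e3 e4]]]]]]] Hg x y p Hp u v e.
  destruct (Hg x y p Hp (u ∘ r) (v ∘ r')) as [h [E1 E2]].
  - now rewrite compc_assoc, e, <- !compc_assoc, e4.
  - exists (h ∘ s'); split.
    + now rewrite <- compc_assoc, <- e3, compc_assoc, E1, <- compc_assoc, e1, compc_idr.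
    + now rewrite compc_assoc, E2, <- compc_assoc, e2, compc_idr.
Qed.

End ClassProperties.

(** The way back from cells to typed arrows. The result is a subset type, so that families of arrows
    can be defined from it. *)
Lemma typed_cell (C : Category) (c : cell C) (x y : C) :
  src c = x -> tgt c = y -> {f : x ~> y | Cell f = c}.
Proof. destruct c as [x' y' f]; cbn; intros <- <-; now exists f. Qed.

(** * Iso-comma objects *)

Section EquationSystem.
Variables (I E : Type) (ep : E -> bool -> I).

(** Equation [e] has two sides, indexed by booleans, and [ep e b] is the unknown on side [b]. An
    arrow from [i] to [e] is a side on which [i] occurs, so an unknown on both sides gives a
    parallel pair. *)
Definition shape_arr (x y : I + E) : Type :=
  match x, y with
  | inl i, inl i' => i = i'
  | inl i, inr e => {b | ep e b = i}
  | inr e, inl i => False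
  | inr e, inr e' => e = e'
  end.

Definition shape_id (x : I + E) : shape_arr x x :=
  match x with inl i => eq_refl | inr e => eq_refl end.

Definition shape_comp (x y z : I + E) : shape_arr y z -> shape_arr x y -> shape_arr x z.
Proof.
  destruct x as [i|e], y as [i'|e'], z as [i''|e'']; cbn; try contradiction.
  - intros [] p; exact p.
  - intros h p; destruct p; exact h.
  - intros p h; destruct p; exact h.
  - intros [] p; exact p.
Defined.

Lemma shape_assoc x y z w (h : shape_arr z w) (g : shape_arr y z) (f : shape_arr x y) :
  shape_comp h (shape_comp g f) = shape_comp (shape_comp h g) f.
Proof.
  destruct x, y, z, w; cbn in *; try contradiction;
    repeat match goal with p : _ = _ |- _ => destruct p end; reflexivity.
Qed.

Lemma shape_idl x y (f : shape_arr x y) : shape_comp (shape_id y) f = f.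
Proof. destruct x, y; cbn in *; try contradiction; reflexivity. Qed.

Lemma shape_idr x y (f : shape_arr x y) : shape_comp f (shape_id x) = f.
Proof.
  destruct x, y; cbn in *; try contradiction; [destruct f|..|destruct f]; reflexivity.
Qed.

(** The limit of a diagram of this shape solves equations between
    1-cells: one unknown for each [i : I], one equation for each [e : E]. *)
Definition shape : Category :=
  {| obj := I + E; arr := shape_arr; idc := shape_id; compc := shape_comp;
     compc_assoc := shape_assoc; compc_idl := shape_idl; compc_idr := shape_idr |}.

Lemma shape_finite : Finite I -> Finite E -> finite_category shape.
Proof.
  intros [lI HI] [lE HE]; split.
  - exists (map inl lI ++ map inr lE); intros [i|e]; apply in_or_app;
      [left|right]; now apply in_map.
  (* [I] and [E] need not have decidable equality; hom-types that are propositions are finite by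
     excluded middle and proof irrelevance. *)
  - assert (P : forall A : Prop, Finite A).
    { intros A; destruct (excluded_middle_informative A) as [a|n].
      - exists (a :: nil); intros a'; left; apply proof_irrelevance.
      - exists nil; intros a'; contradiction. }
    intros [i|e] [i'|e']; cbn; try apply P.
    assert (Q : forall b, exists l : list {b | ep e' b = i}, forall s, proj1_sig s = b -> In s l).
    { intros b; destruct (excluded_middle_informative (ep e' b = i)) as [h|n].
      - exists (exist _ b h :: nil); intros [b' h'] e; cbn in e; subst b'.
        left; f_equal; apply proof_irrelevance.
      - exists nil; intros [b' h'] e; cbn in e; subst b'; contradiction. }
    destruct (Q true) as [l1 H1], (Q false) as [l2 H2].
    exists (l1 ++ l2); intros s; apply in_or_app.
    destruct s as [[|] h]; [left; now apply H1 | right; now apply H2].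
Qed.

Variable K : TwoCategory.
Variables (A : I -> K) (Z : E -> K) (f : forall e b, hom (A (ep e b)) (Z e)).

Definition shape_ob (j : shape) : underlying K :=
  match j with inl i => A i | inr e => Z e end.

Definition shape_map (j k : shape) : j ~> k -> shape_ob j ~> shape_ob k.
Proof.
  destruct j as [i|e], k as [i'|e']; cbn; try contradiction.
  - intros []; exact (one _).
  - intros [b []]; exact (f e' b).
  - intros []; exact (one _).
Defined.

Program Definition diagram : Functor shape (underlying K) :=
  {| fob := shape_ob; fmap := shape_map |}.
Next Obligation. destruct x; reflexivity. Qed.
Next Obligation.
  destruct x, y, z; cbn in *; try contradiction;
    repeat match goal with
    | p : _ = _ |- _ => destruct p
    | p : sig _ |- _ => destruct p
    end; cbn; now rewrite ?hcomp_onel, ?hcomp_oner.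
Qed.

(** Both dimensions of the universal property are merged into one statement on cells: the sources
    and targets of [m] form two cones, giving 1-cells [h] and [h'], and [m] itself gives the 2-cell
    between them. The case of 1-cells is recovered through identity cells. *)
Lemma equation_system_limit :
  Finite I -> Finite E -> has_finite_conical_limits K ->
  exists (P : K) (L : forall i, hom P (A i)),
    (forall e, f e true · L _ = f e false · L _) /\
    forall (X : K) (m : forall i, cell (hom X (A i))),
      (forall e, ⌜f e true⌝ ** m _ = ⌜f e false⌝ ** m _) ->
      exists! c : cell (hom X P), forall i, ⌜L i⌝ ** c = m i.
Proof.
  intros FI FE H.
  destruct (H shape diagram (shape_finite FI FE)) as [P [L [L1 L2]]].
  assert (Lf : forall e b, f e b · L (inl (ep e b)) = L (inr e)).
  { intros e b.
    exact (@leg_comm _ _ _ _ L (inl (ep e b)) (inr e) (exist _ b eq_refl)). }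
  exists P, (fun i => L (inl i)); split.
  { intros e; now rewrite !Lf. }
  intros X m Hm.
  (* The component at an equation is computed from its side [true]; [Hm] says that side [false]
     yields the same. *)
  set (mm := fun j : shape => match j return cell (hom X (shape_ob j)) with
                   | inl i => m i | inr e => ⌜f e true⌝ ** m _ end).
  assert (Hmm : forall (j k : shape) (u : j ~> k),
      ⌜(fmap diagram u : hom (shape_ob j) (shape_ob k))⌝ ** mm j = mm k).
  { intros [i|e] [i'|e'] u; try contradiction.
    - destruct u; apply hc_onel.
    - destruct u as [[|] []]; cbn; [reflexivity | now rewrite Hm].
    - destruct u; apply hc_onel. }
  assert (M1 : exists M : Cone diagram X, forall j, M j = src (mm j)).
  { unshelve eexists {| leg := fun j => src (mm j) : hom X (diagram j) |}; [|reflexivity].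
    intros j k u; exact (f_equal (@src _) (Hmm j k u)). }
  assert (M2 : exists M : Cone diagram X, forall j, M j = tgt (mm j)).
  { unshelve eexists {| leg := fun j => tgt (mm j) : hom X (diagram j) |}; [|reflexivity].
    intros j k u; exact (f_equal (@tgt _) (Hmm j k u)). }
  destruct M1 as [M1 HM1], M2 as [M2 HM2].
  destruct (L1 X M1) as [h [Hh Uh]], (L1 X M2) as [h' [Hh' Uh']].
  assert (T : exists t : forall j, L j · h ~> L j · h', forall j, Cell (t j) = mm j).
  { assert (T : forall j, {t : L j · h ~> L j · h' | Cell t = mm j}).
    { intros j; apply typed_cell; symmetry; [rewrite Hh | rewrite Hh']; auto. }
    exists (fun j => proj1_sig (T j)); intros j; exact (proj2_sig (T j)). }
  destruct T as [t Ht].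
  destruct (L2 X h h' t) as [a [Ha Ua]].
  { intros j k u; apply arr_eq_cell.
    transitivity (⌜(fmap diagram u : hom (shape_ob j) (shape_ob k))⌝ ** mm j).
    - rewrite <- Ht; reflexivity.
    - rewrite Ht; apply Hmm. }
  exists (Cell a); split.
  - intros i; transitivity (Cell (t (inl i))).
    + rewrite <- Ha; reflexivity.
    + apply (Ht (inl i)).
  - intros c Hc.
    assert (Hc' : forall j, ⌜L j⌝ ** c = mm j).
    { intros [i|e]; [apply Hc|]; cbn.
      rewrite <- (Lf e true), <- hc_id, hc_assoc; now rewrite Hc. }
    assert (S1 : h = src c).
    { apply Uh; intros j; rewrite HM1, <- Hc'; reflexivity. }
    assert (S2 : h' = tgt c).
    { apply Uh'; intros j; rewrite HM2, <- Hc'; reflexivity. }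
    destruct c as [c1 c2 c]; cbn in S1, S2; subst c1 c2; f_equal.
    apply Ua; intros j; apply cell_inj; rewrite Ht; apply Hc'.
Qed.

End EquationSystem.

(** * Cotensors, equifiers and the construction of iso-comma objects *)

Section Isocomma.
Variable K : TwoCategory.

(** [is_arrow_cotensor] in terms of cells, with each unique existence split into a lifting and an
    injectivity property. *)
Record cotensor (A T : K) (s t : hom T A) (l : cell (hom T A)) : Prop := {
  ct_src : src l = s;
  ct_tgt : tgt l = t;
  ct_lift : forall (X : K) (q : cell (hom X A)), exists h, l ** ⌜h⌝ = q;
  ct_inj : forall (X : K) (h h' : hom X T), l ** ⌜h⌝ = l ** ⌜h'⌝ -> h = h';
  ct_lift2 : forall (X : K) (h h' : hom X T) (a b : cell (hom X A)),
      src a = s · h -> tgt a = s · h' -> src b = t · h -> tgt b = t · h' ->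
      b • (l ** ⌜h⌝) = (l ** ⌜h'⌝) • a ->
      exists e, src e = h /\ tgt e = h' /\ ⌜s⌝ ** e = a /\ ⌜t⌝ ** e = b;
  ct_inj2 : forall (X : K) (e e' : cell (hom X T)),
      src e = src e' -> tgt e = tgt e' ->
      ⌜s⌝ ** e = ⌜s⌝ ** e' -> ⌜t⌝ ** e = ⌜t⌝ ** e' -> e = e'
}.

Lemma arrow_cotensor_cotensor (A T : K) (s t : hom T A) (l : s ~> t) :
  is_arrow_cotensor l -> cotensor s t (Cell l).
Proof.
  intros [H1 H2]; split; try reflexivity.
  - intros X [f g q]; destruct (H1 X f g q) as [h [Hh _]].
    exists h; apply cell_eq, Hh.
  - intros X h h' E.
    destruct (H1 X _ _ (l ▷ h)) as [h0 [_ U]].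
    transitivity h0; [symmetry|]; apply U; [constructor|].
    apply arr_eq_cell; symmetry; exact E.
  - intros X h h' [a1 a2 a] [b1 b2 b]; cbn; intros -> -> -> -> E.
    unfold hc in E; cbn in E; rewrite !vc_mor in E; apply cell_inj in E.
    destruct (H2 X h h' a b E) as [e [[E1 E2] _]].
    exists (Cell e); repeat split; unfold hc; cbn; congruence.
  - intros X [x y e] [x' y' e']; cbn; intros <- <- E1 E2.
    unfold hc in E1, E2; cbn in E1, E2.
    apply cell_inj in E1; apply cell_inj in E2; f_equal.
    destruct (H2 X x y (s ◁ e) (t ◁ e)) as [e0 [_ U]].
    + apply cell_inj.
      rewrite <- !vc_mor; apply (interchange (Cell l) (Cell e)).
    + transitivity e0; [symmetry|]; apply U; auto.
Qed.

Lemma bool_finite : Finite bool.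
Proof. exists (true :: false :: nil); intros []; cbn; auto. Qed.

Lemma unit_finite : Finite unit.
Proof. exists (tt :: nil); intros []; cbn; auto. Qed.

Lemma option_bool_finite : Finite (option bool).
Proof.
  exists (None :: Some true :: Some false :: nil); intros [[]|]; cbn; auto.
Qed.

Hypothesis Hlim : has_finite_limits K.

Lemma cotensor_exists (A : K) :
  exists (T : K) (s t : hom T A) (l : cell (hom T A)), cotensor s t l.
Proof.
  destruct (proj2 Hlim A) as [T [s [t [l H]]]].
  exists T, s, t, (Cell l); now apply arrow_cotensor_cotensor.
Qed.

(** The 2-cells [u i] and [v i] are classified by 1-cells into the cotensor of [D], so equifying
    them is a system of two equations in one unknown. Two pairs are equified at once, one for each
    inverse law of the iso-comma object. *)
Lemma equifier_exists (Q D : K) (u v : bool -> cell (hom Q D)) :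
  (forall i, src (u i) = src (v i)) -> (forall i, tgt (u i) = tgt (v i)) ->
  exists (P : K) (e : hom P Q),
    (forall i, u i ** ⌜e⌝ = v i ** ⌜e⌝) /\
    (forall (X : K) (k : hom X Q),
        (forall i, u i ** ⌜k⌝ = v i ** ⌜k⌝) -> exists h, e · h = k) /\
    (forall (X : K) (h h' : hom X P), e · h = e · h' -> h = h') /\
    full e /\ faithful e.
Proof.
  intros Hs Ht.
  destruct (cotensor_exists D) as [T [s [t [l H]]]].
  destruct (ct_lift H (u true)) as [u1 Hu1], (ct_lift H (u false)) as [u0 Hu0],
    (ct_lift H (v true)) as [v1 Hv1], (ct_lift H (v false)) as [v0 Hv0].
  set (w := fun i b : bool =>
    if b then (if i then u1 else u0) else (if i then v1 else v0)).
  assert (Hw : forall i, l ** ⌜w i true⌝ = u i) by now intros [|].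
  assert (Hw' : forall i, l ** ⌜w i false⌝ = v i) by now intros [|].
  clearbody w.
  destruct (@equation_system_limit unit bool (fun _ _ => tt) K (fun _ => Q)
    (fun _ => T) w unit_finite bool_finite (proj1 Hlim)) as [P [L [L1 L2]]].
  set (e := L tt) in *.
  assert (Li : forall X (a a' : cell (hom X P)), ⌜e⌝ ** a = ⌜e⌝ ** a' -> a = a').
  { intros X a a' E.
    destruct (L2 X (fun _ => ⌜e⌝ ** a)) as [c [_ Hc]].
    - intros i; now rewrite <- !hc_assoc, !hc_id, L1.
    - transitivity c; [symmetry|]; apply Hc; intros []; auto. }
  assert (Ll : forall X (b : cell (hom X Q)),
      (forall i, ⌜w i true⌝ ** b = ⌜w i false⌝ ** b) -> exists a, ⌜e⌝ ** a = b).
  { intros X b Hb; destruct (L2 X (fun _ => b) Hb) as [c [Hc _]]; exists c; apply (Hc tt). }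
  assert (Inj : forall (X : K) (h h' : hom X P), e · h = e · h' -> h = h').
  { intros X h h' E; apply cid_inj, Li; rewrite !hc_id; congruence. }
  exists P, e; repeat split; auto.
  - intros i; rewrite <- Hw, <- Hw', !hc_assoc, !hc_id; unfold e; now rewrite L1.
  - intros X k Hk; destruct (Ll X ⌜k⌝) as [a Ha].
    + intros i; rewrite !hc_id; f_equal; apply (ct_inj H).
      rewrite <- !hc_id, <- !hc_assoc, Hw, Hw'; apply Hk.
    + exists (src a); exact (f_equal (@src _) Ha).
  - intros X x x' b es et; destruct (Ll X b) as [a Ha].
    (* As [u i] and [v i] are parallel, their classifying 1-cells agree after [s] and [t]. Hence
       whether they agree on [b] depends only on the endpoints of [b], which factor through [e]. *)
    + assert (W : forall i, s · w i true = s · w i false /\ t · w i true = t · w i false).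
      { intros i; specialize (Hs i); specialize (Ht i).
        rewrite <- Hw, <- Hw' in Hs, Ht; cbn in Hs, Ht.
        now rewrite (ct_src H) in Hs; rewrite (ct_tgt H) in Ht. }
      intros i; destruct (W i) as [W1 W2]; apply (ct_inj2 H); cbn.
      * rewrite es, !hcomp_assoc; unfold e; now rewrite L1.
      * rewrite et, !hcomp_assoc; unfold e; now rewrite L1.
      * now rewrite <- !hc_assoc, !hc_id, W1.
      * now rewrite <- !hc_assoc, !hc_id, W2.
    + exists a; repeat split; auto; apply Inj.
      * rewrite <- es, <- Ha; reflexivity.
      * rewrite <- et, <- Ha; reflexivity.
  - intros X a a' _ _; apply Li.
Qed.

(** This is the pseudolimit of the arrow [p]. Both dimensions of its universal property are again
    split into lifting and injectivity. *)
Record isocomma (C D : K) (p : hom C D) (P : K) (c : hom P C) (d : hom P D)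
    (l : cell (hom P D)) : Prop := {
  ic_iso : ciso l;
  ic_src : src l = d;
  ic_tgt : tgt l = p · c;
  ic_lift : forall (X : K) (x : hom X C) (b : cell (hom X D)),
      ciso b -> tgt b = p · x -> exists h, c · h = x /\ l ** ⌜h⌝ = b;
  ic_inj : forall (X : K) (h h' : hom X P),
      c · h = c · h' -> l ** ⌜h⌝ = l ** ⌜h'⌝ -> h = h';
  ic_lift2 : forall (X : K) (h h' : hom X P) (a : cell (hom X C)) (b : cell (hom X D)),
      src a = c · h -> tgt a = c · h' -> src b = d · h -> tgt b = d · h' ->
      (l ** ⌜h'⌝) • b = (⌜p⌝ ** a) • (l ** ⌜h⌝) ->
      exists e, src e = h /\ tgt e = h' /\ ⌜c⌝ ** e = a /\ ⌜d⌝ ** e = b;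
  ic_inj2 : forall (X : K) (e e' : cell (hom X P)),
      src e = src e' -> tgt e = tgt e' ->
      ⌜c⌝ ** e = ⌜c⌝ ** e' -> ⌜d⌝ ** e = ⌜d⌝ ** e' -> e = e'
}.

(** Turns a compatibility of 2-cells with [u] and [v] into one with their inverses; it serves to
    lift 2-cells to the component that holds the inverse. *)
Lemma inverse_square (C : Category) (u u' v v' a b : cell C) :
  inverse_cells u u' -> inverse_cells v v' ->
  src b = src u -> tgt b = src v -> src a = tgt u -> tgt a = tgt v ->
  v • b = a • u -> b • u' = v' • a.
Proof.
  intros Hu Hv e1 e2 e3 e4 E.
  pose proof Hu as [u1 [u2 [u3 u4]]]; pose proof Hv as [v1 [v2 [v3 v4]]].
  apply (vc_cancel_r Hu); rewrite ?vc_src, ?vc_tgt by congruence; try congruence.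
  rewrite <- !vc_assoc by congruence.
  rewrite <- E, u3, vc_assoc, v3, vc_idl, vc_idr; congruence.
Qed.

(** The equation system on [B], [G] and [c0] makes the 2-cells named by [B] and [G] composable in
    both orders and the target of the first equal to [p · c0]. The equifier then imposes the two
    inverse laws. *)
Lemma isocomma_exists (C D : K) (p : hom C D) :
  exists (P : K) (c : hom P C) (d : hom P D) (l : cell (hom P D)), isocomma p c d l.
Proof.
  destruct (cotensor_exists D) as [T [s [t [l H]]]].
  (* [Some true] is a 2-cell, [Some false] its inverse, [None] the 1-cell to [C] *)
  set (ob := fun i : option bool => match i with Some _ => T | None => C end).
  set (ep := fun e b : option bool => b : option bool).
  destruct (@equation_system_limit (option bool) (option bool)
    (fun e b => match e with
       | Some _ => Some b
       | None => if b then Some true else None end) K ob (fun _ => D)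
    (fun e b => match e with
       | Some true => if b return hom (ob (Some b)) D then s else t
       | Some false => if b return hom (ob (Some b)) D then t else s
       | None => if b return hom (ob (if b then Some true else None)) D then t else p
       end)
    option_bool_finite option_bool_finite (proj1 Hlim)) as [Q [L [L1 L2]]].
  set (B := L (Some true) : hom Q T); set (G := L (Some false) : hom Q T);
    set (c0 := L None : hom Q C).
  assert (E1 : s · B = t · G) by exact (L1 (Some true)).
  assert (E2 : t · B = s · G) by exact (L1 (Some false)).
  assert (E3 : t · B = p · c0) by exact (L1 None).
  assert (Ll : forall X (b g : cell (hom X T)) (a : cell (hom X C)),
      ⌜s⌝ ** b = ⌜t⌝ ** g -> ⌜t⌝ ** b = ⌜s⌝ ** g -> ⌜t⌝ ** b = ⌜p⌝ ** a ->
      exists q, ⌜B⌝ ** q = b /\ ⌜G⌝ ** q = g /\ ⌜c0⌝ ** q = a).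
  { intros X b g a h1 h2 h3.
    destruct (L2 X (fun i => match i return cell (hom X (ob i)) with
      Some true => b | Some false => g | None => a end)) as [q [Hq _]].
    - intros [[|]|]; assumption.
    - exists q; split; [exact (Hq (Some true))|split];
        [exact (Hq (Some false)) | exact (Hq None)]. }
  assert (Li : forall X (q q' : cell (hom X Q)),
      ⌜B⌝ ** q = ⌜B⌝ ** q' -> ⌜G⌝ ** q = ⌜G⌝ ** q' -> ⌜c0⌝ ** q = ⌜c0⌝ ** q' -> q = q').
  { intros X q q' h1 h2 h3.
    destruct (L2 X (fun i => ⌜L i⌝ ** q)) as [q0 [_ U]].
    - intros e; rewrite <- !hc_assoc, !hc_id; now rewrite L1.
    - transitivity q0; [symmetry|]; apply U; [auto|].
      intros [[|]|]; symmetry; assumption. }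
  clearbody B G c0; clear L1 L2 L ep ob.
  pose proof (ct_src H) as ls; pose proof (ct_tgt H) as lt.
  assert (c1 : tgt (l ** ⌜B⌝) = src (l ** ⌜G⌝)) by (cbn; congruence).
  assert (c2 : tgt (l ** ⌜G⌝) = src (l ** ⌜B⌝)) by (cbn; congruence).
  destruct (@equifier_exists Q D
    (fun i : bool => if i then (l ** ⌜G⌝) • (l ** ⌜B⌝) else (l ** ⌜B⌝) • (l ** ⌜G⌝))
    (fun i : bool => if i then ⌜s · B⌝ else ⌜s · G⌝))
    as [P [e [e1 [e2 [e3 [e4 e5]]]]]].
  { intros [|]; rewrite vc_src by auto; cbn; congruence. }
  { intros [|]; rewrite vc_tgt by auto; cbn; congruence. }
  assert (Inv : inverse_cells (l ** ⌜B · e⌝) (l ** ⌜G · e⌝)).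
  { pose proof (e1 true) as i1; pose proof (e1 false) as i2; cbn in i1, i2.
    rewrite hc_vc_r, !hc_assoc, !hc_id in i1 by auto.
    rewrite hc_vc_r, !hc_assoc, !hc_id in i2 by auto.
    repeat split; cbn; rewrite ?ls, ?lt, ?hcomp_assoc; congruence. }
  assert (Inv' : forall X (h : hom X P),
      inverse_cells (l ** ⌜B · e · h⌝) (l ** ⌜G · e · h⌝)).
  { intros X h; rewrite <- !(hc_id _ h), <- !hc_assoc.
    apply inverse_hc; [exact Inv|]; repeat split; cbn; now rewrite ?vc_idl. }
  exists P, (c0 · e), (s · (B · e)), (l ** ⌜B · e⌝); split.
  - eapply inverse_ciso; exact Inv.
  - cbn; congruence.
  - cbn; rewrite lt, !hcomp_assoc; congruence.
  - intros X x b Hb eb.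
    destruct (ciso_inverse Hb) as [b' [i1 [i2 [i3 i4]]]].
    destruct (ct_lift H b) as [h Hh], (ct_lift H b') as [h' Hh'].
    destruct (Ll X ⌜h⌝ ⌜h'⌝ ⌜x⌝) as [q [q1 [q2 q3]]].
    1-3: rewrite !hc_id; f_equal; rewrite <- ?ls, <- ?lt.
    1: transitivity (src b); [rewrite <- Hh | rewrite <- i2, <- Hh']; reflexivity.
    1: transitivity (tgt b); [rewrite <- Hh | rewrite i1, <- Hh']; reflexivity.
    1: rewrite <- eb, <- Hh; reflexivity.
    apply (f_equal (@src _)) in q1, q2, q3; cbn in q1, q2, q3.
    set (k := src q) in *; clearbody k; clear q.
    destruct (e2 X k) as [k' Hk'].
    + intros [|]; rewrite hc_vc_r, !hc_assoc, !hc_id, q1, q2, Hh, Hh' by auto.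
      * rewrite i3, <- hcomp_assoc, q1, <- Hh; cbn; congruence.
      * rewrite i4, <- hcomp_assoc, q2, <- Hh'; cbn; congruence.
    + exists k'; split; [now rewrite <- hcomp_assoc, Hk'|].
      now rewrite hc_assoc, hc_id, <- hcomp_assoc, Hk', q1.
  - intros X h h' h1 h2; rewrite !hc_assoc, !hc_id in h2.
    apply e3, cid_inj, Li; rewrite !hc_id; f_equal; rewrite !hcomp_assoc.
    + now apply (ct_inj H).
    (* The [G]-components agree because inverses are unique. *)
    + apply (ct_inj H); apply (inverse_unique (Inv' X h)); rewrite h2; apply Inv'.
    + exact h1.
  - intros X h h' a b a1 a2 b1 b2 E.
    rewrite !hc_assoc, !hc_id in E.
    destruct (@ct_lift2 _ _ _ _ _ H X (B · e · h) (B · e · h') b (⌜p⌝ ** a))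
      as [B' [B1 [B2 [B3 B4]]]]; cbn.
    + now rewrite b1, !hcomp_assoc.
    + now rewrite b2, !hcomp_assoc.
    + now rewrite a1, !hcomp_assoc, E3.
    + now rewrite a2, !hcomp_assoc, E3.
    + congruence.
    (* At the inverse, the roles of [b] and [p a] are exchanged, and the required square is the
       inverted one. *)
    + destruct (@ct_lift2 _ _ _ _ _ H X (G · e · h) (G · e · h') (⌜p⌝ ** a) b)
        as [G' [G1 [G2 [G3 G4]]]]; cbn.
      * now rewrite a1, !hcomp_assoc, <- E2, E3.
      * now rewrite a2, !hcomp_assoc, <- E2, E3.
      * now rewrite b1, !hcomp_assoc, <- E1.
      * now rewrite b2, !hcomp_assoc, <- E1.
      * apply (inverse_square (Inv' X h) (Inv' X h')); cbn; auto;
          rewrite ?ls, ?lt, ?a1, ?a2, ?b1, ?b2, !hcomp_assoc; congruence.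
      * destruct (Ll X B' G' a) as [q [q1 [q2 q3]]]; try congruence.
        assert (S : forall k (k' : hom X P), B · k = B · e · k' -> G · k = G · e · k' ->
            c0 · k = c0 · e · k' -> k = e · k').
        { intros k k' k1 k2 k3; apply cid_inj, Li; rewrite !hc_id, hcomp_assoc;
            congruence. }
        destruct (e4 X h h' q) as [r [r1 [r2 r3]]].
        -- apply S; [rewrite <- B1, <- q1 | rewrite <- G1, <- q2 | rewrite <- a1, <- q3];
             reflexivity.
        -- apply S; [rewrite <- B2, <- q1 | rewrite <- G2, <- q2 | rewrite <- a2, <- q3];
             reflexivity.
        -- exists r; repeat split; auto.
           ++ now rewrite <- hc_id, hc_assoc, r3.
           ++ now rewrite <- !hc_id, !hc_assoc, r3, q1.
  - intros X r r' r1 r2 r3 r4.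
    assert (Q1 : ⌜t⌝ ** ⌜B⌝ ** ⌜e⌝ ** r = ⌜t⌝ ** ⌜B⌝ ** ⌜e⌝ ** r').
    { rewrite <- !(hc_assoc ⌜t⌝), hc_id, E3, <- hc_id, !hc_assoc; f_equal.
      now rewrite <- !hc_assoc, hc_id. }
    assert (Q2 : ⌜s⌝ ** ⌜B⌝ ** ⌜e⌝ ** r = ⌜s⌝ ** ⌜B⌝ ** ⌜e⌝ ** r').
    { rewrite <- !hc_id, !hc_assoc in r4; exact r4. }
    apply e5; auto; apply Li.
    + apply (ct_inj2 H); cbn; congruence.
    + apply (ct_inj2 H); cbn; try congruence.
      * rewrite <- !(hc_assoc ⌜s⌝), hc_id, <- E2, <- hc_id, !hc_assoc; exact Q1.
      * rewrite <- !(hc_assoc ⌜t⌝), hc_id, <- E1, <- hc_id, !hc_assoc; exact Q2.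
    + rewrite <- !hc_assoc, hc_id; exact r3.
Qed.

End Isocomma.

(** * The two projections of an iso-comma object *)

Section IsocommaProperties.
Variable K : TwoCategory.

Lemma equivalence_one (A : K) : is_equivalence (one A).
Proof. exists (one A); rewrite hcomp_onel; split; apply isomorphic_refl. Qed.

Lemma inverse_whisker (X B C : K) (l l' : cell (hom B C)) (h : hom X B) :
  inverse_cells l l' -> inverse_cells (l ** ⌜h⌝) (l' ** ⌜h⌝).
Proof.
  intros H; apply inverse_hc; [exact H|]; repeat split; cbn; now rewrite ?vc_idl.
Qed.

Variables (C D : K) (p : hom C D) (P : K) (c : hom P C) (d : hom P D)
  (l : cell (hom P D)).
Hypothesis H : isocomma p c d l.

Lemma isocomma_natural (X : K) (e : cell (hom X P)) :
  (l ** ⌜tgt e⌝) • (⌜d⌝ ** e) = (⌜p⌝ ** ⌜c⌝ ** e) • (l ** ⌜src e⌝).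
Proof.
  rewrite <- hc_assoc, hc_id, <- (ic_src H), <- (ic_tgt H); symmetry; apply interchange.
Qed.

(** A strict preimage of [x] is classified by the identity of [p · x]. Since [l] is invertible, the
    [d]-component of a 2-cell is its [c]-component whiskered by [p] and conjugated by [l], which
    gives fullness and faithfulness. *)
Lemma isocomma_proj_trivial_fibration : is_trivial_fibration c.
Proof.
  destruct (ciso_inverse (ic_iso H)) as [l' Hl].
  pose proof (ic_src H) as ls; pose proof (ic_tgt H) as lt.
  apply surjective_full_faithful_trivial_fibration.
  - intros X x; destruct (@ic_lift _ _ _ _ _ _ _ _ H X x ⌜p · x⌝) as [h [Hh _]]; auto.
    + apply ciso_cid.
    + now exists h.
  - intros X x x' a a1 a2.
    pose proof (inverse_whisker x' Hl) as [i1 [i2 [i3 i4]]].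
    assert (s1 : tgt (l ** ⌜x⌝) = src (⌜p⌝ ** a)) by
      (cbn; rewrite lt, a1; now rewrite hcomp_assoc).
    assert (s2 : tgt (⌜p⌝ ** a) = src (l' ** ⌜x'⌝)).
    { rewrite <- i1; cbn; rewrite lt, a2; now rewrite hcomp_assoc. }
    assert (s3 : tgt ((⌜p⌝ ** a) • (l ** ⌜x⌝)) = src (l' ** ⌜x'⌝)) by now rewrite vc_tgt.
    destruct (@ic_lift2 _ _ _ _ _ _ _ _ H X x x' a
      ((l' ** ⌜x'⌝) • ((⌜p⌝ ** a) • (l ** ⌜x⌝)))) as [e [e1 [e2 [e3 _]]]]; auto.
    + rewrite !vc_src by auto; cbn; now rewrite ls.
    + rewrite !vc_tgt by auto; rewrite i2; cbn; now rewrite ls.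
    + rewrite (vc_assoc (c := l ** ⌜x'⌝)), i4, <- s3, vc_idl by auto; auto.
    + now exists e.
  - intros X e e' h1 h2 E; apply (ic_inj2 H); auto.
    apply (vc_cancel_l (inverse_whisker (tgt e) Hl)); cbn; try congruence.
    rewrite h2 at 2; rewrite !isocomma_natural; congruence.
Qed.

(** The lift of [b] keeps the [C]-component fixed and replaces the classified 2-cell by its
    composite with [b]. The lift lies over an identity under [c], hence is invertible. *)
Lemma isocomma_isofibration : is_isofibration d.
Proof.
  pose proof (ic_src H) as ls; pose proof (ic_tgt H) as lt.
  destruct (trivial_fibration_full_faithful isocomma_proj_trivial_fibration) as [F1 F2].
  apply isofibration_cell; intros X x b Hb e.
  assert (s : tgt b = src (l ** ⌜x⌝)) by (cbn; congruence).
  destruct (@ic_lift _ _ _ _ _ _ _ _ H X (c · x) ((l ** ⌜x⌝) • b)) as [x' [h1 h2]].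
  - apply ciso_vc; auto; apply ciso_hc; [apply (ic_iso H) | apply ciso_cid].
  - rewrite vc_tgt by auto; cbn; rewrite lt; now rewrite hcomp_assoc.
  - assert (s' : src b = d · x').
    { rewrite <- (vc_src s), <- h2; cbn; now rewrite ls. }
    destruct (@ic_lift2 _ _ _ _ _ _ _ _ H X x' x ⌜c · x⌝ b) as [a [a1 [a2 [a3 a4]]]];
      auto.
    + rewrite hc_id, vc_idl; [now rewrite h2|].
      cbn; rewrite lt, <- hcomp_assoc; congruence.
    + exists a; repeat split; auto.
      apply (full_faithful_ciso (f := c)); auto; rewrite a3; apply ciso_cid.
Qed.

Lemma isocomma_section_equivalence (i : hom C P) : c · i = one C -> is_equivalence i.
Proof.
  intros E; apply equivalence_cancel_l with (g := c).
  - apply isocomma_proj_trivial_fibration.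
  - rewrite E; apply equivalence_one.
Qed.

End IsocommaProperties.

(** * Lifting *)

Section Leibniz.
Variable K : TwoCategory.
Hypothesis Hlim : has_finite_limits K.

(** [Q] classifies invertible 2-cells of [C], and [q : Q -> P] applies [p] to them. It is an
    equivalence by two-out-of-three over [C], and surjective because [p] is an isofibration. The
    data form a square from [i] to [q]: [u] classifies [a], [v] classifies [b], and a filler
    classifies [e]. *)
Lemma leibniz_lift (A B C D : K) (i : hom A B) (p : hom C D)
    (Hi : is_cofibration i) (Hp : is_isofibration p)
    (h : hom B C) (a : cell (hom A C)) (b : cell (hom B D)) :
  ciso a -> ciso b -> tgt a = h · i -> tgt b = p · h -> ⌜p⌝ ** a = b ** ⌜i⌝ ->
  exists e, ciso e /\ tgt e = h /\ e ** ⌜i⌝ = a /\ ⌜p⌝ ** e = b.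
Proof.
  intros Ha Hb ea eb E.
  destruct (isocomma_exists Hlim p) as [P [c [d [l H]]]].
  destruct (isocomma_exists Hlim (one C)) as [Q [c1 [c0 [m H1]]]].
  assert (Hm : forall X (x : hom X Q), ciso (m ** ⌜x⌝))
    by (intros; apply ciso_hc; [apply (ic_iso H1) | apply ciso_cid]).
  assert (mt : tgt m = c1) by (rewrite (ic_tgt H1); apply hcomp_onel).
  destruct (@ic_lift _ _ _ _ _ _ _ _ H Q c1 (⌜p⌝ ** m)) as [q [q1 q2]].
  - apply ciso_hc; [apply ciso_cid | apply (ic_iso H1)].
  - cbn; now rewrite mt.
  - assert (Hq : is_trivial_fibration q).
    { assert (Eq : is_equivalence q).
      { apply equivalence_cancel_l with (g := c).
        - apply (isocomma_proj_trivial_fibration H).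
        - rewrite q1; apply (isocomma_proj_trivial_fibration H1). }
      apply surjective_full_faithful_trivial_fibration;
        [|now apply equivalence_full | now apply equivalence_faithful].
      intros X y.
      destruct (proj1 (isofibration_cell p) Hp X (c · y) (l ** ⌜y⌝)) as [a' [a1 [a2 a3]]].
      - apply ciso_hc; [apply (ic_iso H) | apply ciso_cid].
      - cbn; rewrite (ic_tgt H); now rewrite hcomp_assoc.
      - destruct (@ic_lift _ _ _ _ _ _ _ _ H1 X (c · y) a') as [z [z1 z2]]; auto.
        + now rewrite hcomp_onel.
        + exists z; apply (ic_inj H).
          * now rewrite hcomp_assoc, q1.
          * now rewrite <- hc_id, <- hc_assoc, q2, hc_assoc, z2. }
    destruct (@ic_lift _ _ _ _ _ _ _ _ H1 A (h · i) a) as [u [u1 u2]]; auto.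
    { now rewrite hcomp_onel. }
    destruct (@ic_lift _ _ _ _ _ _ _ _ H B h b) as [v [v1 v2]]; auto.
    destruct (Hi Q P q Hq u v) as [w [w1 w2]]; cbn in *.
    { apply (ic_inj H).
      - now rewrite !hcomp_assoc, q1, v1.
      - now rewrite <- !hc_id, <- !hc_assoc, q2, hc_assoc, u2, v2. }
    exists (m ** ⌜w⌝); repeat split.
    + apply Hm.
    + cbn; now rewrite mt, <- q1, <- hcomp_assoc, w2.
    + now rewrite hc_assoc, hc_id, w1.
    + now rewrite <- hc_assoc, <- q2, hc_assoc, hc_id, w2.
Qed.

(** Equivalences are self-dual, so the results on postcomposition apply to precomposition. *)
Lemma op_equivalence (A B : K) (f : hom A B) :
  is_equivalence f -> is_equivalence (K := op K) f.
Proof. intros [g [H1 H2]]; exists g; split; assumption. Qed.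

Lemma precomp_full (A B : K) (i : hom A B) : is_equivalence i ->
  forall (X : K) (x x' : hom B X) (b : cell (hom A X)),
    src b = x · i -> tgt b = x' · i ->
    exists a : cell (hom B X), src a = x /\ tgt a = x' /\ a ** ⌜i⌝ = b.
Proof. intros H; exact (equivalence_full (op_equivalence H)). Qed.

Lemma precomp_faithful (A B : K) (i : hom A B) : is_equivalence i ->
  forall (X : K) (a a' : cell (hom B X)),
    src a = src a' -> tgt a = tgt a' -> a ** ⌜i⌝ = a' ** ⌜i⌝ -> a = a'.
Proof. intros H; exact (equivalence_faithful (op_equivalence H)). Qed.

(** The 1-cell [u · g] fills the square up to invertible 2-cells; [leibniz_lift] replaces it by an
    isomorphic 1-cell, the source of [e], that fills it strictly. *)
Lemma trivial_cofibration_lifting (A B C D : K) (i : hom A B) (p : hom C D) :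
  is_cofibration i -> is_equivalence i -> is_isofibration p ->
  has_lifting (C := underlying K) i p.
Proof.
  intros Hi Hw Hp u v E; cbn in *.
  pose proof Hw as [g [G _]].
  apply isomorphic_sym, isomorphic_cell in G; destruct G as [eta [N1 [N2 N3]]].
  (* The equation defining [eps] is a triangle identity for [i] and [g]. It makes the 2-cells
     [u eta] and [v eps] compatible over [i] and [p]. *)
  destruct (@precomp_full A B i Hw B (one B) (i · g) (⌜i⌝ ** eta))
    as [eps [P1 [P2 P3]]].
  { cbn; now rewrite N2, hcomp_oner, hcomp_onel. }
  { cbn; now rewrite N3, hcomp_assoc. }
  assert (P4 : ciso eps).
  { apply (@full_faithful_ciso (op K) B A i B eps).
    - exact (equivalence_full (op_equivalence Hw)).
    - exact (equivalence_faithful (op_equivalence Hw)).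
    - change (ciso (eps ** ⌜i⌝)); rewrite P3; apply ciso_hc; [apply ciso_cid | exact N1]. }
  destruct (@leibniz_lift A B C D i p Hi Hp (u · g) (⌜u⌝ ** eta) (⌜v⌝ ** eps))
    as [e [e1 [e2 [e3 e4]]]].
  - apply ciso_hc; [apply ciso_cid | exact N1].
  - apply ciso_hc; [apply ciso_cid | exact P4].
  - cbn; now rewrite N3, hcomp_assoc.
  - cbn; now rewrite P2, !hcomp_assoc, E.
  - now rewrite hc_assoc, P3, <- !hc_assoc, !hc_id, E.
  - exists (src e); split.
    + transitivity (src (e ** ⌜i⌝)); [reflexivity | rewrite e3].
      cbn; rewrite N2; apply hcomp_oner.
    + transitivity (src (⌜p⌝ ** e)); [reflexivity | rewrite e4].
      cbn; rewrite P1; apply hcomp_oner.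
Qed.

Lemma leibniz_isofibration (A B C D : K) (i : hom A B) (p : hom C D) :
  is_cofibration i -> is_isofibration p ->
  isofibration_of_categories (leibniz_hom i p).
Proof.
  intros Hi Hp h [f g ef] [a b eab] [[a' b' eab'] [I1 I2]]; cbn in *.
  apply (f_equal (@pb_arr_fst _ _ _ _ _ _ _)) in I1 as I1a, I2 as I2a.
  apply (f_equal (@pb_arr_snd _ _ _ _ _ _ _)) in I1 as I1b, I2 as I2b.
  cbn in *; clear I1 I2.
  destruct (@leibniz_lift A B C D i p Hi Hp h (Cell a) (Cell b))
    as [[h' h'' e] [e1 [e2 [e3 e4]]]]; auto.
  - now exists a'.
  - now exists b'.
  - apply cell_eq, eab.
  - cbn in e2; subst h''.
    exists h', e; split; [exact e1|].
    assert (F1 : h' · i = f) by exact (f_equal (@src _) e3).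
    assert (F2 : p · h' = g) by exact (f_equal (@src _) e4).
    subst f g; apply cell_inj in e3, e4; subst a b.
    cbn in *; rewrite (proof_irrelevance _ ef (hcomp_assoc p h' i)).
    apply arr_eq_of_eq, pb_arr_ext; reflexivity.
Qed.

End Leibniz.

(** Choice of strict preimages gives an inverse with [F (G y) = y]. Both natural isomorphisms then
    lie over identity cells, and working with cells avoids transport along these equations. *)
Lemma surjective_full_faithful_equivalence (C D : Category) (F : Functor C D) :
  (forall y, exists x, F x = y) ->
  (forall (x x' : C) (g : F x ~> F x'), exists f, fmap F f = g) ->
  (forall (x x' : C) (f f' : x ~> x'), fmap F f = fmap F f' -> f = f') ->
  equivalence_of_categories F.
Proof.
  intros Hs Hf Hf'.
  assert (Go : forall y, {x | F x = y})
    by (intros y; apply constructive_indefinite_description, Hs).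
  set (G := fun y => proj1_sig (Go y)).
  assert (EG : forall y, F (G y) = y) by (intros y; exact (proj2_sig (Go y))).
  clearbody G; clear Go.
  assert (Fl : forall (x x' : C) (b : cell D), src b = F x -> tgt b = F x' ->
      {f : x ~> x' | Cell (fmap F f) = b}).
  { intros x x' b e1 e2; destruct (typed_cell e1 e2) as [b' <-].
    destruct (constructive_indefinite_description _ (Hf x x' b')) as [f <-].
    now exists f. }
  assert (Fc : forall x x' (f f' : x ~> x'),
      Cell (fmap F f) = Cell (fmap F f') -> f = f').
  { intros x x' f f' E; apply Hf', cell_inj, E. }
  assert (FF : forall x y z (g : y ~> z) (f : x ~> y),
      Cell (fmap F (g ∘ f)) = Cell (fmap F g) • Cell (fmap F f)).
  { intros; now rewrite fmap_comp, vc_mor. }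
  assert (Gm : forall y y' (g : y ~> y'), {f : G y ~> G y' | Cell (fmap F f) = Cell g}).
  { intros; apply Fl; now rewrite EG. }
  set (gm := fun y y' (g : y ~> y') => proj1_sig (Gm y y' g)).
  assert (Egm : forall y y' (g : y ~> y'), Cell (fmap F (gm y y' g)) = Cell g)
    by (intros; exact (proj2_sig (Gm _ _ _))).
  clearbody gm; clear Gm.
  unshelve eexists {| fob := G; fmap := gm |}.
  { intros y; apply Fc; rewrite Egm, fmap_id; cbn; now rewrite EG. }
  { intros x y z g f; apply Fc; now rewrite FF, !Egm, vc_mor. }
  assert (Fiso : forall x x' (f : x ~> x'), ciso (Cell (fmap F f)) -> is_iso f).
  { intros x x' f [g [e1 e2]]; cbn in *.
    destruct (Hf _ _ g) as [f' <-]; exists f'.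
    split; apply Hf'; now rewrite fmap_comp, fmap_id. }
  split.
  - assert (T : forall x, {t : G (F x) ~> x | Cell (fmap F t) = cid (F x)})
      by (intros x; apply Fl; cbn; now rewrite ?EG).
    exists (fun x => proj1_sig (T x)); split.
    + intros x y f; cbn.
      destruct (T x) as [s Hs'], (T y) as [t Ht]; cbn.
      apply Fc; rewrite !FF, Egm, Hs', Ht, vc_idl, vc_idr; auto.
    + intros x; destruct (T x) as [s Hs']; cbn; apply Fiso.
      rewrite Hs'; apply ciso_cid.
  - assert (T : forall y, {t : F (G y) ~> y | Cell t = cid y})
      by (intros y; apply typed_cell; cbn; now rewrite ?EG).
    exists (fun y => proj1_sig (T y)); split.
    + intros x y f; cbn.
      destruct (T x) as [s Hs'], (T y) as [t Ht]; cbn.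
      apply cell_inj; rewrite <- !vc_mor, Egm, Hs', Ht, vc_idl, vc_idr; auto.
    + intros y; destruct (T y) as [t Ht]; cbn.
      change (ciso (Cell t)); rewrite Ht; apply ciso_cid.
Qed.

(** * When the functor [leibniz_hom] is an equivalence; the terminal object *)

Section Conclusion.
Variable K : TwoCategory.

(** Surjectivity on objects is the lifting property. For 2-cells, the component on the side of the
    equivalence determines the lift; the other component then agrees because whiskering with an
    equivalence is faithful. *)
Lemma leibniz_equivalence (Hlim : has_finite_limits K)
    (A B C D : K) (i : hom A B) (p : hom C D) :
  is_cofibration i -> is_isofibration p -> is_equivalence i \/ is_equivalence p ->
  equivalence_of_categories (leibniz_hom i p).
Proof.
  intros Hi Hp Hw.
  apply surjective_full_faithful_equivalence.
  - intros [f g e]; cbn in *.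
    assert (L : has_lifting (C := underlying K) i p).
    { destruct Hw as [Hw|Hw].
      - now apply trivial_cofibration_lifting.
      - now apply Hi. }
    destruct (L f g e) as [h [h1 h2]]; cbn in *; subst f g.
    exists h; cbn; f_equal; apply proof_irrelevance.
  - intros h h' [a b e]; cbn in *.
    pose proof (cell_eq e) as E.
    destruct Hw as [Hw|Hw].
    + destruct (precomp_full Hw (X := C) (x := h) (x' := h') (b := Cell a))
        as [[x y c] [c1 [c2 c3]]]; auto.
      cbn in c1, c2; subst x y.
      exists c; apply pb_arr_ext; cbn; apply cell_inj; [exact c3|].
      apply (precomp_faithful Hw); auto.
      transitivity (⌜p⌝ ** Cell a); [|exact E].
      rewrite <- c3, <- hc_assoc; reflexivity.
    + destruct (equivalence_full Hw (X := B) (x := h) (x' := h') (b := Cell b))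
        as [[x y c] [c1 [c2 c3]]]; auto.
      cbn in c1, c2; subst x y.
      exists c; apply pb_arr_ext; cbn; apply cell_inj; [|exact c3].
      apply (equivalence_faithful Hw); auto.
      transitivity (Cell b ** ⌜i⌝); [|symmetry; exact E].
      rewrite <- c3, hc_assoc; reflexivity.
  - intros h h' c c' E; cbn in *.
    pose proof (f_equal (@pb_arr_fst _ _ _ _ _ _ _) E) as E1.
    pose proof (f_equal (@pb_arr_snd _ _ _ _ _ _ _) E) as E2.
    cbn in E1, E2; apply cell_inj.
    destruct Hw as [Hw|Hw].
    + apply (precomp_faithful Hw); auto.
      unfold hc; cbn; now rewrite E1.
    + apply (equivalence_faithful Hw); auto.
      unfold hc; cbn; now rewrite E2.
Qed.

(** The solution of the empty equation system. Its clause on 2-cells makes every object fibrant. *)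
Lemma terminal_exists : has_finite_limits K ->
  exists T : K, is_terminal (C := underlying K) T /\
    forall (X : K) (a b : cell (hom X T)), a = b.
Proof.
  intros H.
  assert (F : Finite Empty_set) by (exists nil; intros []).
  destruct (@equation_system_limit Empty_set Empty_set
    (fun e _ => match e with end) K (fun i => match i with end)
    (fun e => match e with end) (fun e _ => match e with end) F F (proj1 H))
    as [T [L [_ HL]]].
  assert (U : forall (X : K) (a b : cell (hom X T)), a = b).
  { intros X a b.
    destruct (HL X (fun i => match i with end)) as [c [_ Hc]]; [intros []|].
    transitivity c; [symmetry|]; apply Hc; intros []. }
  exists T; split; [|exact U].
  intros X; destruct (HL X (fun i => match i with end)) as [c _]; [intros []|].
  exists (src c); split; [exact I|].
  intros f _; apply cid_inj, U.
Qed.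

End Conclusion.

(** * Functorial factorizations *)

Record isocomma_of (K : TwoCategory) (C D : K) (p : hom C D) : Type := {
  ic_ob : K;
  ic_dom : hom ic_ob C;
  ic_cod : hom ic_ob D;
  ic_cell : cell (hom ic_ob D);
  ic_prop : isocomma p ic_dom ic_cod ic_cell
}.

Lemma choose_isocomma (K : TwoCategory) (H : has_finite_limits K)
    (C D : K) (p : hom C D) : isocomma_of p.
Proof.
  (* The iso-comma object is packed into one record so that choice extracts all of it from a mere
     existence statement. *)
  apply (fun h => proj1_sig (constructive_indefinite_description (fun _ => True) h)).
  destruct (isocomma_exists H p) as [P [c [d [l E]]]].
  now exists {| ic_prop := E |}.
Qed.

Section Factorization.
Variable K : TwoCategory.
Variable ic : forall (A B : K) (f : hom A B), isocomma_of f.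

(** The section is the 1-cell classified by the identity 2-cell of [f]. *)
Definition path_section_sig (A B : K) (f : hom A B) :
  {i : hom A (ic_ob (ic f)) | ic_dom (ic f) · i = one A /\ ic_cell (ic f) ** ⌜i⌝ = ⌜f⌝}.
Proof.
  apply constructive_indefinite_description, (ic_lift (ic_prop (ic f))).
  - apply ciso_cid.
  - symmetry; apply hcomp_oner.
Qed.

Definition path_section (A B : K) (f : hom A B) := proj1_sig (path_section_sig f).

Lemma path_section_dom (A B : K) (f : hom A B) :
  ic_dom (ic f) · path_section f = one A.
Proof. exact (proj1 (proj2_sig (path_section_sig f))). Qed.

Lemma path_section_cell (A B : K) (f : hom A B) :
  ic_cell (ic f) ** ⌜path_section f⌝ = ⌜f⌝.
Proof. exact (proj2 (proj2_sig (path_section_sig f))). Qed.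

Lemma path_section_cod (A B : K) (f : hom A B) :
  ic_cod (ic f) · path_section f = f.
Proof.
  rewrite <- (ic_src (ic_prop (ic f))).
  exact (f_equal (@src _) (path_section_cell f)).
Qed.

Definition path_map_sig (A B A' B' : K) (f : hom A B) (f' : hom A' B')
    (u : hom A A') (v : hom B B') (sq : v · f = f' · u) :
  {h : hom (ic_ob (ic f)) (ic_ob (ic f')) |
    ic_dom (ic f') · h = u · ic_dom (ic f) /\
    ic_cell (ic f') ** ⌜h⌝ = ⌜v⌝ ** ic_cell (ic f)}.
Proof.
  apply constructive_indefinite_description, (ic_lift (ic_prop (ic f'))).
  - apply ciso_hc; [apply ciso_cid | apply (ic_iso (ic_prop (ic f)))].
  - cbn; rewrite (ic_tgt (ic_prop (ic f))), !hcomp_assoc; now rewrite sq.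
Qed.

Definition path_map (A B A' B' : K) (f : hom A B) (f' : hom A' B')
    (u : hom A A') (v : hom B B') (sq : v · f = f' · u) :=
  proj1_sig (path_map_sig sq).

Lemma path_map_dom (A B A' B' : K) (f : hom A B) (f' : hom A' B')
    (u : hom A A') (v : hom B B') (sq : v · f = f' · u) :
  ic_dom (ic f') · path_map sq = u · ic_dom (ic f).
Proof. exact (proj1 (proj2_sig (path_map_sig sq))). Qed.

Lemma path_map_cell (A B A' B' : K) (f : hom A B) (f' : hom A' B')
    (u : hom A A') (v : hom B B') (sq : v · f = f' · u) :
  ic_cell (ic f') ** ⌜path_map sq⌝ = ⌜v⌝ ** ic_cell (ic f).
Proof. exact (proj2 (proj2_sig (path_map_sig sq))). Qed.

(** Although [path_map] is obtained by choice, [ic_inj] determines it from its components, so the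
    functor laws hold strictly. *)
Program Definition path_factorization : functorial_factorization (underlying K) :=
  {| ff_mid := fun A B f => ic_ob (ic f);
     ff_left := fun A B f => path_section f;
     ff_right := fun A B f => ic_cod (ic f);
     ff_map := fun A B A' B' f f' u v sq => path_map sq |}.
Next Obligation. intros; apply path_section_cod. Qed.
Next Obligation.
  intros; cbn in *; apply (ic_inj (ic_prop (ic f'))).
  - rewrite !hcomp_assoc, path_map_dom, path_section_dom, <- hcomp_assoc.
    now rewrite path_section_dom, hcomp_onel, hcomp_oner.
  - rewrite <- !hc_id, <- !hc_assoc, path_map_cell, path_section_cell, hc_assoc.
    now rewrite path_section_cell, !hc_id, sq.
Qed.
Next Obligation.
  intros; cbn in *.
  rewrite <- (ic_src (ic_prop (ic f'))), <- (ic_src (ic_prop (ic f))).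
  exact (f_equal (@src _) (path_map_cell sq)).
Qed.
Next Obligation.
  intros; cbn in *; apply (ic_inj (ic_prop (ic f))).
  - now rewrite path_map_dom, hcomp_onel, hcomp_oner.
  - now rewrite path_map_cell, hc_onel, hc_oner.
Qed.
Next Obligation.
  intros; cbn in *; apply (ic_inj (ic_prop (ic f''))).
  - now rewrite path_map_dom, !hcomp_assoc, path_map_dom, <- !hcomp_assoc, path_map_dom.
  - now rewrite <- hc_id, <- hc_assoc, !path_map_cell, hc_assoc, path_map_cell,
      <- hc_assoc, hc_id.
Qed.

Lemma path_left_equivalence (A B : underlying K) (f : A ~> B) :
  is_equivalence (ff_left path_factorization f).
Proof.
  apply (isocomma_section_equivalence (ic_prop (ic f))), path_section_dom.
Qed.

Lemma path_right_isofibration (A B : underlying K) (f : A ~> B) :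
  is_isofibration (ff_right path_factorization f).
Proof. apply (isocomma_isofibration (ic_prop (ic f))). Qed.

End Factorization.

(** * Composition and duality of functorial factorizations *)

Section FactorizationAlgebra.

Lemma ff_map_eq (C : Category) (F : functorial_factorization C)
    (x y x' y' : C) (f : x ~> y) (f' : x' ~> y') (u u' : x ~> x') (v v' : y ~> y')
    (sq : v ∘ f = f' ∘ u) (sq' : v' ∘ f = f' ∘ u') :
  u = u' -> v = v' -> ff_map F sq = ff_map F sq'.
Proof. intros <- <-; f_equal; apply proof_irrelevance. Qed.

(** The left factor of [F] is factored once more by [G], and the two right factors are composed. *)
Program Definition comp_factorization (C : Category)
    (F G : functorial_factorization C) : functorial_factorization C :=
  {| ff_mid := fun x y f => ff_mid G (ff_left F f);
     ff_left := fun x y f => ff_left G (ff_left F f);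
     ff_right := fun x y f => ff_right F f ∘ ff_right G (ff_left F f);
     ff_map := fun x y x' y' f f' u v sq => ff_map G (ff_map_left F sq) |}.
Next Obligation. intros; rewrite <- compc_assoc; now rewrite !ff_fact. Qed.
Next Obligation. intros; apply ff_map_left. Qed.
Next Obligation.
  intros; now rewrite <- compc_assoc, ff_map_right, compc_assoc, ff_map_right, compc_assoc.
Qed.
Next Obligation.
  intros; rewrite <- (@ff_map_id C G _ _ (ff_left F f)
    (eq_trans (compc_idl _) (eq_sym (compc_idr _)))).
  apply ff_map_eq; [reflexivity | apply ff_map_id].
Qed.
Next Obligation.
  intros.
  assert (sq3 : (ff_map F sq' ∘ ff_map F sq) ∘ ff_left F f = ff_left F f'' ∘ (u' ∘ u)).
  { now rewrite <- compc_assoc, ff_map_left, compc_assoc, ff_map_left, compc_assoc. }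
  rewrite <- (@ff_map_comp C G _ _ _ _ _ _ _ _ _ _ _ _ _
    (ff_map_left F sq) (ff_map_left F sq') sq3).
  apply ff_map_eq; [reflexivity | apply ff_map_comp].
Qed.

Program Definition dual_factorization (K : TwoCategory)
    (F : functorial_factorization (underlying (op K))) :
    functorial_factorization (underlying K) :=
  {| ff_mid := fun A B f => @ff_mid _ F B A f;
     ff_left := fun A B f => @ff_right _ F B A f;
     ff_right := fun A B f => @ff_left _ F B A f;
     ff_map := fun A B A' B' f f' u v sq =>
       @ff_map _ F B' A' B A f' f v u (eq_sym sq) |}.
Next Obligation. intros; exact (@ff_fact _ F y x f). Qed.
Next Obligation.
  intros; exact (@ff_map_right _ F y' x' y x f' f v u (eq_sym sq)).
Qed.
Next Obligation.
  intros; exact (@ff_map_left _ F y' x' y x f' f v u (eq_sym sq)).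
Qed.
Next Obligation.
  intros; exact (@ff_map_id _ F y x f (eq_sym sq)).
Qed.
Next Obligation.
  intros.
  exact (@ff_map_comp _ F y'' x'' y' x' y x f'' f' f v' u' v u
    (eq_sym sq') (eq_sym sq) (eq_sym sq'')).
Qed.

End FactorizationAlgebra.

(** * The mapping cylinder *)

Section Cylinder.
Variable K : TwoCategory.
Variable ic : forall (A B : op K) (f : hom A B), isocomma_of f.

Definition cylinder_factorization : functorial_factorization (underlying K) :=
  dual_factorization (path_factorization ic).

(** The right factor is the path section of [op K]: read in [K], the projection [ic_dom] becomes a
    strict section of it, and its being an equivalence is self-dual. *)
Lemma cylinder_right_trivial_fibration (A B : underlying K) (f : A ~> B) :
  is_trivial_fibration (ff_right cylinder_factorization f).
Proof.
  apply (@section_equivalence_trivial_fibration K _ _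
    (ff_right cylinder_factorization f) (ic_dom (ic (A := B) (B := A) f))).
  - exact (path_section_dom ic (A := B) (B := A) f).
  - destruct (path_left_equivalence ic (A := B) (B := A) f) as [g [H1 H2]].
    exists g; split; [exact H2 | exact H1].
Qed.

(** An extension of a square along the cylinder inclusion of [f] amounts to a
    lift [z] of its restriction to [B] and an invertible 2-cell
    [u ≅ z · f] over the given one. *)
Lemma cylinder_left_cofibration (A B : underlying K) (f : A ~> B) :
  is_cofibration (ff_left cylinder_factorization f).
Proof.
  intros C D p Hp u v E; cbn in *.
  set (I := ic (A := B) (B := A) f) in *.
  pose proof (ic_prop I) as H.
  set (P := ic_ob I : K) in *; set (c := ic_dom I : hom B P) in *;
    set (d := ic_cod I : hom A P) in *; set (l := ic_cell I : cell (hom A P)) in *.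
  clearbody P c d l; clear I.
  pose proof (ic_iso H : ciso l) as li.
  pose proof (ic_src H : src l = d) as ls; pose proof (ic_tgt H : tgt l = c · f) as lt.
  destruct (trivial_fibration_full_faithful Hp) as [Hf Hf'].
  destruct (trivial_fibration_surjective Hp (v · c)) as [z Hz].
  destruct (Hf A u (z · f) (⌜v⌝ ** l)) as [b [b1 [b2 b3]]]; cbn.
  - now rewrite ls, E.
  - now rewrite lt, !hcomp_assoc, Hz.
  - assert (Hb : ciso b).
    { apply (full_faithful_ciso (f := p)); auto; rewrite b3.
      apply ciso_hc; [apply ciso_cid | exact li]. }
    destruct (@ic_lift _ _ _ _ _ _ _ _ H C z b Hb b2) as [h [h1 h2]].
    change (obj (hom (t := K) P C)) in h; change (h · c = z) in h1; change (⌜h⌝ ** l = b) in h2.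
    exists h; split.
    + rewrite <- b1, <- h2, <- ls; reflexivity.
    + apply (@ic_inj _ _ _ _ _ _ _ _ H).
      * change ((p · h) · c = v · c); now rewrite <- hcomp_assoc, h1.
      * change (⌜p · h⌝ ** l = ⌜v⌝ ** l); now rewrite <- hc_id, hc_assoc, h2.
Qed.

End Cylinder.

(** * Assembly of the model structure *)

Lemma functorial_factorizations_factorizations (C : Category) (L R : mor_class C) :
  has_functorial_factorizations L R -> has_factorizations L R.
Proof.
  intros [F H] x y f; exists (ff_mid F f), (ff_left F f), (ff_right F f).
  split; [apply ff_fact | apply H].
Qed.

Theorem theorem3p3 (K : TwoCategory)
    (finlim : has_finite_limits K) (fincolim : has_finite_colimits K) :
  model_Cat_category (@is_equivalence K) (@is_cofibration K) (@is_isofibration K)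
  /\ has_functorial_factorizations (@is_cofibration K) (@is_trivial_fibration K)
  /\ has_functorial_factorizations
       (class_inter (@is_cofibration K) (@is_equivalence K)) (@is_isofibration K)
  /\ (forall A : underlying K,
        is_fibrant (@is_isofibration K) A /\ is_cofibrant (@is_cofibration K) A).
Proof.
  set (F := path_factorization (choose_isocomma finlim)).
  set (G := cylinder_factorization (choose_isocomma fincolim)).
  assert (HG : forall (A B : underlying K) (f : A ~> B),
      is_cofibration (ff_left G f) /\ is_trivial_fibration (ff_right G f)).
  { intros; split;
      [apply cylinder_left_cofibration | apply cylinder_right_trivial_fibration]. }
  assert (H1 : has_functorial_factorizations (@is_cofibration K) (@is_trivial_fibration K))
    by (exists G; exact HG).
  assert (H2 : has_functorial_factorizations
       (class_inter (@is_cofibration K) (@is_equivalence K)) (@is_isofibration K)).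
  { exists (comp_factorization F G); intros A B f; cbn; split; [split|].
    - apply HG.
    - destruct (HG _ _ (ff_left F f)) as [_ [_ H]].
      (* Following the cylinder inclusion by the trivial fibration [ff_right G] gives back the path
         section, which is an equivalence. *)
      apply (equivalence_cancel_l H).
      change (is_equivalence (ff_right G (ff_left F f) ∘ ff_left G (ff_left F f))).
      rewrite ff_fact; apply path_left_equivalence.
    - apply isofibration_comp; [apply HG | apply path_right_isofibration]. }
  split; [|split; [exact H1|split; [exact H2|]]].
  - split; auto.
    + split.
      * intros x y z g f Hf Hg; exact (equivalence_comp Hf Hg).
      * intros x y z g f; apply equivalence_cancel_l.
      * intros x y z g f; apply equivalence_cancel_r.
      * apply equivalence_retract.
      * apply llp_retract.
      * apply isofibration_retract.
      * intros a b c d i p Hi Hp; exact (Hi _ _ _ Hp).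
      * intros a b c d i p [Hi Hw] Hp; now apply trivial_cofibration_lifting.
      * now apply functorial_factorizations_factorizations.
      * now apply functorial_factorizations_factorizations.
    + intros; now apply leibniz_isofibration.
    + intros; now apply leibniz_equivalence.
  - intros A; split.
    + destruct (terminal_exists finlim) as [T [HT U]].
      destruct (HT A) as [f _]; exists T, f; split; [exact HT|].
      apply isofibration_cell; intros X x b Hb e.
      (* All 2-cells into the terminal object are equal, so the identity of [x] is a lift. *)
      exists ⌜x⌝; repeat split; [apply ciso_cid | apply U].
    + destruct (terminal_exists (K := op K) fincolim) as [T [HT _]].
      destruct (HT A) as [f _]; exists T, f; split; [exact HT|].
      (* Out of the initial object one triangle commutes automatically; what remains is surjectivity
         of the trivial fibration [p]. *)
      intros C D p Hp u v E.
      destruct (trivial_fibration_surjective Hp v) as [z Hz].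
      exists z; split; [|exact Hz].
      destruct (HT C) as [w [_ Hw]].
      transitivity w; [symmetry|]; now apply Hw.
Qed.
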